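(* Let $x$ and $Q$ be sufficiently large real numbers with $\sqrt{2x} < Q \leq x$, and let $\mathcal{A} = (a_n)_{n \leq x}$ be a complex sequence. Suppose that: (Progressions Condition) for some $K_{\text{prog}} > 0$, $$ \sum_{1 \leq r \leq 2x/Q} \sum_{1 \leq a \leq r} \Biggl( \sum_{n \leq x, n \equiv a \bmod r} |a_{n}| \Biggr) \max_{z \leq x} \left| \mathcal{A}(z;r,a) - \mathrm{Aver}(\mathcal{A},z;r,(a,r)) \right| \leq \frac{(\sum_{n \leq x} |a_n|)^2}{K_{\text{prog}}} ;$$ (Non-concentration on Multiples) for every $H \leq Q$ there is some $K_{\text{conc}}[H] > 0$ with $$ \sum_{H \leq h \leq Q} \Biggl( \sum_{n \leq x,\, h \mid n} |a_{n}| \Biggr)^2 \leq \frac{(\sum_{n \leq x} |a_n|)^2}{K_{\text{conc}}[H]} ;$$ (Hereditarily Sparse) for some $K_{\text{hered}} > 0$, for every positive integer $h \leq 2x/Q$ and every interval $I$ of length $Q/2$, $$ \sum_{n \in I} |a_{nh}| \tau(n) \leq \frac{1}{K_{\text{hered}}} \frac{(\sum_{n \leq x} |a_n|)^2}{\sum_{n \leq x} |a_n| \tau_{3}(n)} .$$ Then $$ V(\mathcal{A},x,Q) = \frac{Q}{2} \sum_{n \leq x} |a_n|^2 + O\left( \Bigl(\sum_{n \leq x} |a_n|\Bigr)^2 \left( \frac{1}{K_{\text{prog}}} + \frac{1}{K_{\text{conc}}[2x/Q]} + \frac{\log^{2}(2x/Q)}{K_{\text{hered}}} \right) + \sum_{n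 \leq x} |a_n|^2 \tau(n) \right),$$ where the implied constant is absolute.
   Context: For a complex sequence $\mathcal{A}=(a_n)_{n\le x}$ (with $a_m$ interpreted as $0$ for $m > x$), $z \le x$, $q \in \mathbb{N}$ and $a \in \mathbb{Z}$, define $\mathcal{A}(z;q,a) := \sum_{n \leq z,\, n \equiv a \bmod q} a_n$, and for $h \mid q$ define $\mathrm{Aver}(\mathcal{A},z;q,h) := \frac{1}{\phi(q/h)} \sum_{1 \leq a \leq q,\, (a,q)=h} \mathcal{A}(z;q,a)$, where $\phi$ is Euler's totient function. Define $$V(\mathcal{A},x,Q) := \sum_{Q/2 < q \leq Q} \sum_{1 \leq a \leq q} \left|\mathcal{A}(x;q,a) - \mathrm{Aver}(\mathcal{A},x;q,(a,q)) \right|^{2}.$$ Here $\tau(n)$ is the number of divisors of $n$ and $\tau_3(n) := \#\{(u,v,w)\in\mathbb{N}^3 : uvw = n\}$. Sums over $n$ are over positive integers. *)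

(* Defs.v *)
From mathcomp Require Import all_boot all_order all_algebra.
From mathcomp Require Import complex.
From mathcomp Require Import all_classical all_reals all_analysis.

Set Implicit Arguments.
Unset Strict Implicit.
Unset Printing Implicit Defensive.

Import Order.TTheory GRing.Theory Num.Theory.

Local Open Scope classical_set_scope.
Local Open Scope ring_scope.

(* A sequence (a_n)_{n <= x} is given by a function nat -> R[i] of which only
   the values at 1 <= n <= x matter.  A sum over the positive integers n <= z,
   z real, is \sum_(1 <= n < (Num.truncn z).+1); it is empty when z < 1. *)

Definition cabs (R : realType) (z : R[i]) : R := ComplexField.Normc.normc z.

Definition tau (n : nat) : nat := size (divisors n).

(* For n > 0, the factors in u v w = n are automatically positive and <= n. *)
Definition tau3 (n : nat) : nat :=
  #|[set t : 'I_n.+1 * 'I_n.+1 * 'I_n.+1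
      | (t.1.1 * t.1.2 * t.2 == n :> nat)%N]%SET|.

(* The convention a_m = 0 for m > x. *)
Definition zero_ext (R : realType) (a : nat -> R[i]) (x : R) (m : nat) : R[i] :=
  if m%:R <= x then a m else 0.

Definition prog_sum (R : realType) (a : nat -> R[i]) (z : R) (q : nat) (c : int)
    : R[i] :=
  \sum_(1 <= n < (Num.truncn z).+1 | (n%:Z == c %[mod q%:Z])%Z) a n.

Definition Aver (R : realType) (a : nat -> R[i]) (z : R) (q h : nat) : R[i] :=
  ((totient (q %/ h))%:R)^-1 *
  \sum_(1 <= c < q.+1 | gcdn c q == h) prog_sum a z q c%:Z.

Definition discrepancy (R : realType) (a : nat -> R[i]) (z : R) (q c : nat) : R :=
  cabs (prog_sum a z q c%:Z - Aver a z q (gcdn c q)).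

Definition Vvar (R : realType) (a : nat -> R[i]) (x Q : R) : R :=
  \sum_(1 <= q < (Num.truncn Q).+1 | Q / 2 < q%:R)
    \sum_(1 <= c < q.+1) discrepancy a x q c ^+ 2.

Definition sum_abs (R : realType) (a : nat -> R[i]) (x : R) : R :=
  \sum_(1 <= n < (Num.truncn x).+1) cabs (a n).

(* The maximum over real z <= x is written as a supremum: the discrepancy
   takes only finitely many values there, as it depends on z through
   Num.truncn z alone. *)
Definition progressions_condition (R : realType) (a : nat -> R[i])
    (x Q Kprog : R) : Prop :=
  \sum_(1 <= r < (Num.truncn (2 * x / Q)).+1)
    \sum_(1 <= c < r.+1)
      (\sum_(1 <= n < (Num.truncn x).+1 | (n == c %[mod r])%N) cabs (a n))
      * sup [set discrepancy a z r c | z in [set z : R | z <= x]]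
  <= sum_abs a x ^+ 2 / Kprog.

Definition non_concentration (R : realType) (a : nat -> R[i])
    (x Q H KconcH : R) : Prop :=
  \sum_(1 <= h < (Num.truncn Q).+1 | H <= h%:R)
    (\sum_(1 <= n < (Num.truncn x).+1 | (h %| n)%N) cabs (a n)) ^+ 2
  <= sum_abs a x ^+ 2 / KconcH.

(* The booleans lb and rb let each endpoint of the interval be open or closed. *)
Definition hereditarily_sparse (R : realType) (a : nat -> R[i])
    (x Q Khered : R) : Prop :=
  forall h : nat, (0 < h)%N -> h%:R <= 2 * x / Q ->
  forall (lb rb : bool) (u v : R), v - u = Q / 2 ->
  \sum_(1 <= n < (Num.truncn v).+1
        | (n%:R : R) \in Interval (BSide lb u) (BSide rb v))
    cabs (zero_ext a x (n * h)) * (tau n)%:R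
  <= Khered^-1 *
     (sum_abs a x ^+ 2
      / \sum_(1 <= n < (Num.truncn x).+1) cabs (a n) * (tau3 n)%:R).

(* Main.v *)
Require Import Defs.
From mathcomp Require Import all_boot all_order all_algebra.
From mathcomp Require Import complex.
From mathcomp Require Import all_classical all_reals all_analysis.
From mathcomp Require Import ring lra zify.

(** The variance is a quadratic form, so real and imaginary parts are treated
    separately.  For a real sequence [b], [V] is the sum over [m, n] of
    [b m * b n * k_q(m, n)], where
    [k_q(m, n) = [m = n mod q] - [(m,q) = (n,q)] / phi(q / (m,q))].
    The diagonal of the congruence part gives the main term.  Off the diagonal,
    [n - m = q r] with [Q/2 < q <= Q] is the same as [r | n - m] and
    [r Q/2 < |n - m| <= r Q] with [r <= 2x/Q], and the progressions condition
    replaces [[m = n mod r]] by [[(m,r) = (n,r)] / phi(r / (m,r))].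

    What remains is, for each common divisor [h] of [m] and [n], with [m = h m'],
    [n = h n'] and [N = m' n'], the difference of the sums of
    [[(r,N) = 1] / phi(r)] over the two dyadic ranges [|m'-n'|/Q <= r < 2|m'-n'|/Q]
    and [Q/(2h) < r <= Q/h].  Writing [[(r,N) = 1] r / phi(r)] as a divisor sum of
    a function [G_N] supported on squarefree numbers, both have the same main term,
    and they differ by [O(tau(m') tau(n') (1 + log j) / j)] when [|m'-n'|] is about
    [j Q / 2].  Large [h] are absorbed by non-concentration; for small [h], summing
    over intervals of length [Q/2] yields hereditary sparsity times
    [log^2(2x/Q)]. *)

Set Implicit Arguments.
Unset Strict Implicit.
Unset Printing Implicit Defensive.

Import Order.TTheory GRing.Theory Num.Theory.
Local Open Scope ring_scope.

(** * Divisor sums *)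

Definition squarefree (n : nat) : bool :=
  all (fun p => ~~ (p ^ 2 %| n)%N) (primes n).

Lemma squarefreeP (n : nat) : (0 < n)%N ->
  reflect (forall p, prime p -> ~~ (p ^ 2 %| n)%N) (squarefree n).
Proof.
move=> n0; apply: (iffP allP) => H p.
  move=> pp; apply/negP => pn.
  have: p \in primes n by rewrite mem_primes pp n0 (dvdn_trans _ pn) // expnS dvdn_mulr.
  by move/H/negP; apply.
by rewrite mem_primes => /andP[pp _]; apply: H.
Qed.

Lemma perm_primes_mulX (p m k : nat) : prime p -> coprime p m -> (0 < m)%N ->
  (0 < k)%N -> perm_eq (primes (m * p ^ k)%N) (p :: primes m).
Proof.
move=> pp cpm m0 k0.
have pnm : ~~ (p %| m)%N by rewrite -prime_coprime.
apply: uniq_perm => [||q]; first exact: primes_uniq.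
  by rewrite /= primes_uniq mem_primes (negbTE pnm) !andbF.
by rewrite primesM ?expn_gt0 ?(prime_gt0 pp) // primesX // (primes_prime pp) !inE orbC.
Qed.

Lemma squarefree_mul_prime (p d : nat) : prime p -> coprime p d -> (0 < d)%N ->
  squarefree (p * d)%N = squarefree d.
Proof.
move=> pp cpd d0.
have pd0 : (0 < p * d)%N by rewrite muln_gt0 prime_gt0.
apply/(squarefreeP pd0)/(squarefreeP d0) => H q qp.
  by apply: contra (H q qp) => qd; exact: dvdn_mull.
apply/negP; have [->|qNp] := eqVneq q p.
  rewrite expnS expn1 dvdn_pmul2l ?prime_gt0 // => pd.
  by move: cpd; rewrite prime_coprime // pd.
rewrite Gauss_dvdr; first by apply/negP; apply: H.
by rewrite coprimeXl // prime_coprime // dvdn_prime2.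
Qed.

Section SquarefreeConvolution.
Variable R : realType.
Implicit Types g : nat -> R.

(** The multiplicative function that lives on squarefree integers and takes the value [g p] at each
    prime [p]; [G_N] is the case [g = totient_coeff N]. *)
Definition sqf_mult g (d : nat) : R :=
  if squarefree d then \prod_(p <- primes d) g p else 0.

Lemma sqf_mult_mul_prime g (p d : nat) : prime p -> coprime p d -> (0 < d)%N ->
  sqf_mult g (p * d)%N = g p * sqf_mult g d.
Proof.
move=> pp cpd d0; rewrite /sqf_mult squarefree_mul_prime //.
case: ifP => _; last by rewrite mulr0.
rewrite -(expn1 p) mulnC (perm_big _ (perm_primes_mulX pp cpd d0 _)) //.
by rewrite big_cons.
Qed.

(** Strong induction, stripping the smallest prime: [n = m p^k] with [p] prime to [m]. Only
    squarefree divisors count, and these are the squarefree divisors [e] of [m] together with the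
    products [p e], which bring the factor [g p]. *)
Lemma sum_divisors_sqf_mult g (n : nat) : (0 < n)%N ->
  \sum_(d <- divisors n) sqf_mult g d = \prod_(p <- primes n) (1 + g p).
Proof.
elim/ltn_ind: n => n IH n0.
have [n1|n1] := leqP n 1.
  have -> : n = 1%N by lia.
  by rewrite big_seq1 /= big_nil /sqf_mult /= big_nil.
have pp : prime (pdiv n) by exact: pdiv_prime.
set p := pdiv n in pp *.
have [m cpm nE] := pfactor_coprime pp n0.
have k0 : (0 < logn p n)%N by rewrite logn_gt0 mem_primes pp n0 pdiv_dvd.
move: k0 nE; set k := logn p n => k0 nE.
have m0 : (0 < m)%N by move: n0; rewrite nE muln_gt0 => /andP[].
have pk : (1 < p ^ k)%N by rewrite -{1}(expn0 p) ltn_exp2l // prime_gt1.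
have mn : (m < n)%N by rewrite nE; apply: ltn_Pmulr.
rewrite [in RHS]nE (perm_big _ (perm_primes_mulX pp cpm m0 k0)) big_cons -IH //.
rewrite (bigID (fun d => p %| d)%N) /= addrC mulrDl mul1r; congr +%R.
  rewrite -big_filter; apply: perm_big; apply: uniq_perm => [||d].
  - by rewrite filter_uniq // divisors_uniq.
  - exact: divisors_uniq.
  rewrite mem_filter -!dvdn_divisors // nE.
  apply/andP/idP => [[pd]|dm].
    by rewrite Gauss_dvdl // coprimeXr // coprime_sym prime_coprime.
  split; last exact: dvdn_mulr.
  apply/negP => pd; move: cpm; rewrite prime_coprime // => /negP; apply.
  exact: dvdn_trans pd dm.
rewrite (bigID squarefree) /= [X in _ + X]big1 ?addr0; last first.
  by move=> d /andP[_ /negbTE sd]; rewrite /sqf_mult sd.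
rewrite [X in _ * X](bigID squarefree) /= [X in _ * (_ + X)]big1 ?addr0; last first.
  by move=> d /negbTE sd; rewrite /sqf_mult sd.
rewrite -big_filter -[X in _ * X]big_filter mulr_sumr.
have cop d : (d %| m)%N -> coprime p d.
  by move=> dm; rewrite (coprime_dvdr dm).
(* If [p e] is squarefree then [e] is prime to [p], so [e] dividing [m p^k] already divides [m]. *)
transitivity (\sum_(d <- [seq (p * d)%N | d <- [seq d <- divisors m | squarefree d]])
   sqf_mult g d).
  apply: perm_big; apply: uniq_perm => [||d].
  - by rewrite filter_uniq // divisors_uniq.
  - rewrite map_inj_uniq ?filter_uniq ?divisors_uniq // => a b /eqP.
    by rewrite eqn_pmul2l ?prime_gt0 // => /eqP.
  rewrite mem_filter -dvdn_divisors //; apply/idP/mapP => [/andP[/andP[/dvdnP[e dE] sd] dn]|].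
    have d0 : (0 < d)%N by rewrite (dvdn_gt0 _ dn).
    have e0 : (0 < e)%N by move: d0; rewrite dE muln_gt0 => /andP[].
    have cpe : coprime p e.
      rewrite prime_coprime //; apply/negP => pe.
      have /squarefreeP -/(_ d0) /(_ _ pp) /negP := sd; apply.
      by rewrite dE expnS expn1 dvdn_pmul2r ?prime_gt0.
    exists e; last by rewrite mulnC.
    rewrite mem_filter -dvdn_divisors //; apply/andP; split.
      by rewrite -(squarefree_mul_prime pp cpe) // mulnC -dE.
    move: dn; rewrite dE nE => dn.
    have: (e %| m * p ^ k)%N by apply: dvdn_trans dn; exact: dvdn_mulr.
    by rewrite Gauss_dvdl // coprimeXr // coprime_sym.
  case=> e; rewrite mem_filter -dvdn_divisors // => /andP[se em] ->.
  have e0 : (0 < e)%N by rewrite (dvdn_gt0 _ em).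
  rewrite dvdn_mulr // squarefree_mul_prime ?cop // se /= nE mulnC.
  by apply: dvdn_mul => //; rewrite -{1}(expn1 p) dvdn_exp2l.
rewrite big_map big_seq [RHS]big_seq; apply: eq_bigr => d.
rewrite mem_filter -dvdn_divisors // => /andP[_ dm].
by rewrite sqf_mult_mul_prime ?cop // (dvdn_gt0 _ dm).
Qed.

End SquarefreeConvolution.

Lemma sum_multiples (V : nmodType) (d B : nat) (u : nat -> V) : (0 < d)%N ->
  \sum_(1 <= n < B.+1 | (d %| n)%N) u n
  = \sum_(1 <= s < (B %/ d).+1) u (d * s)%N.
Proof.
move=> d0.
rewrite -big_filter -(big_map (muln d) xpredT).
apply: perm_big; apply: uniq_perm => [||n].
- by rewrite filter_uniq // iota_uniq.
- rewrite map_inj_uniq ?iota_uniq // => a b /eqP.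
  by rewrite eqn_pmul2l // => /eqP.
rewrite mem_filter mem_index_iota; apply/idP/mapP.
  case/and3P => /dvdnP[s ->] s1 sB; exists s; last by rewrite mulnC.
  rewrite mem_index_iota ltnS leq_divRL //.
  by move: s1 sB; case: s => //; rewrite mul0n.
case=> s; rewrite mem_index_iota ltnS leq_divRL // => /andP[s1 sB] ->.
by rewrite dvdn_mulr //= muln_gt0 d0 s1 ltnS mulnC.
Qed.

Lemma sum_divisors_range (V : nmodType) (r B : nat) (F : nat -> V) :
  (0 < r <= B)%N ->
  \sum_(d <- divisors r) F d = \sum_(1 <= d < B.+1 | (d %| r)%N) F d.
Proof.
case/andP=> r0 rB; rewrite -[RHS]big_filter; apply: perm_big.
apply: uniq_perm => [||d]; rewrite ?filter_uniq ?iota_uniq ?divisors_uniq //.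
rewrite mem_filter mem_index_iota -dvdn_divisors //.
apply/idP/idP => [dr|/andP[]//]; rewrite dr /= (dvdn_gt0 r0 dr) ltnS.
exact: leq_trans (dvdn_leq r0 dr) rB.
Qed.

(** Exchange of summation with [r = d s]. It serves to turn sums weighted by [1 / phi] into harmonic
    sums. *)
Lemma sum_convolution (R : comPzRingType) (B : nat) (u G : nat -> R) :
  \sum_(1 <= r < B.+1) u r * \sum_(d <- divisors r) G d
  = \sum_(1 <= d < B.+1) G d * \sum_(1 <= s < (B %/ d).+1) u (d * s)%N.
Proof.
transitivity (\sum_(1 <= r < B.+1) \sum_(1 <= d < B.+1 | (d %| r)%N) G d * u r).
  rewrite big_nat [RHS]big_nat; apply: eq_bigr => r rB.
  by rewrite (sum_divisors_range _ rB) mulr_sumr; apply: eq_bigr => d _; rewrite mulrC.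
under eq_bigr do rewrite big_mkcond.
rewrite exchange_big /= big_nat [RHS]big_nat; apply: eq_bigr => d /andP[d1 _].
by rewrite -big_mkcond -mulr_sumr sum_multiples.
Qed.

(** Writing [c = h s] turns the condition into coprimality of [s] and [q / h]. *)
Lemma sum_gcd_totient (q h : nat) : (0 < q)%N -> (h %| q)%N ->
  (\sum_(1 <= c < q.+1) (gcdn c q == h) = totient (q %/ h))%N.
Proof.
move=> q0 hq; have h0 := dvdn_gt0 q0 hq.
transitivity (\sum_(1 <= c < q.+1 | (h %| c)%N) (gcdn c q == h))%N.
  rewrite [RHS]big_mkcond; apply: eq_bigr => c _.
  case: ifPn => // hc; apply/eqP; rewrite eqb0; apply: contra hc => /eqP <-.
  exact: dvdn_gcdl.
rewrite (sum_multiples (V := nat)) // totient_count_coprime.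
set n := (q %/ h)%N.
have qE : q = (h * n)%N by rewrite mulnC divnK.
have n0 : (0 < n)%N by rewrite divn_gt0 // dvdn_leq.
transitivity (\sum_(1 <= s < n.+1) coprime n s)%N.
  apply: eq_bigr => s _; congr nat_of_bool.
  rewrite {1}qE -muln_gcdr coprime_sym /coprime.
  by rewrite -{2}[h]muln1 eqn_pmul2l.
(* Here [s] runs over [1 .. n], whereas the totient counts over [0 .. n - 1]; the end terms agree
   since [0] and [n] have the same gcd with [n]. *)
rewrite big_nat_recr //= [RHS]big_ltn //= addnC; congr addn.
by rewrite /coprime gcdnn gcdn0.
Qed.

(** A divisor [d] of [m n] is the product of [g = (d, m)] and [d / g]; the latter divides [n]
    because it is prime to [m / g]. *)
Lemma tau_mul (m n : nat) : (0 < m)%N -> (0 < n)%N ->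
  (tau (m * n) <= tau m * tau n)%N.
Proof.
move=> m0 n0; rewrite /tau -(size_allpairs muln).
apply: uniq_leq_size; first exact: divisors_uniq.
move=> d; rewrite -dvdn_divisors ?muln_gt0 ?m0 // => dmn.
have d0 : (0 < d)%N by rewrite (dvdn_gt0 _ dmn) // muln_gt0 m0.
apply/allpairsP; exists (gcdn d m, d %/ gcdn d m)%N.
have g0 : (0 < gcdn d m)%N by rewrite gcdn_gt0 d0.
split=> /=; first by rewrite -dvdn_divisors // dvdn_gcdr.
  rewrite -dvdn_divisors // -(@Gauss_dvdr _ (m %/ gcdn d m)); last first.
    rewrite /coprime -(eqn_pmul2l g0) muln_gcdr muln1 ![(gcdn d m * _)%N]mulnC.
    by rewrite !divnK ?dvdn_gcdl ?dvdn_gcdr.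
  rewrite -(dvdn_pmul2l g0) mulnA ![(gcdn d m * _)%N]mulnC !divnK ?dvdn_gcdl ?dvdn_gcdr //.
by rewrite mulnC divnK // dvdn_gcdl.
Qed.

Lemma tau_gt0 (n : nat) : (0 < n)%N -> (0 < tau n)%N.
Proof.
move=> n0; rewrite /tau; have := divisor1 n; case: (divisors n) => //.
Qed.

(** The left side counts pairs [(h, d)] with [h | m] and [d | m / h]; such a pair is sent
    injectively to the triple [(d, m / (h d), h)]. *)
Lemma sum_tau_le_tau3 (m : nat) : (0 < m)%N ->
  (\sum_(h <- divisors m) tau (m %/ h) <= tau3 m)%N.
Proof.
move=> m0.
pose L := [seq (h, d) | h <- divisors m, d <- divisors (m %/ h)].
pose f (t : nat * nat) : 'I_m.+1 * 'I_m.+1 * 'I_m.+1 :=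
  (inord t.2, inord (m %/ t.1 %/ t.2), inord t.1).
have memL t : t \in L -> (t.1 %| m)%N && (t.2 %| m %/ t.1)%N.
  case/allpairsPdep => h [d [hm dm ->]] /=.
  move: hm; rewrite -dvdn_divisors // => hm.
  move: dm; rewrite -dvdn_divisors ?hm // divn_gt0 ?(dvdn_gt0 m0 hm) //.
  exact: dvdn_leq.
(* These bounds make [inord] faithful on all three coordinates. *)
have leL t : t \in L -> [/\ (0 < t.1)%N, (t.1 <= m)%N, (t.2 <= m)%N
    & (m %/ t.1 %/ t.2 <= m)%N].
  move=> /memL /andP[hm dm]; have h0 := dvdn_gt0 m0 hm.
  have mh0 : (0 < m %/ t.1)%N by rewrite divn_gt0 // dvdn_leq.
  split=> //; first exact: dvdn_leq.
    exact: leq_trans (dvdn_leq mh0 dm) (leq_div _ _).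
  exact: leq_trans (leq_div _ _) (leq_div _ _).
have -> : (\sum_(h <- divisors m) tau (m %/ h) = size L)%N.
  by rewrite size_allpairs_dep sumnE big_map.
have uL : uniq L.
  apply: allpairs_uniq_dep; first exact: divisors_uniq.
    by move=> h _; exact: divisors_uniq.
  by move=> [h d] [h' d'] _ _ /= [-> ->].
have fL : {in L &, injective f}.
  move=> [h d] [h' d'] /leL [_ a1 a2 _] /leL [_ b1 b2 _] [] /=.
  by move=> /(congr1 val) /= + _ /(congr1 val) /=; rewrite !inordK // => -> ->.
rewrite /tau3 cardE -(size_map f); apply: uniq_leq_size.
  by rewrite map_inj_in_uniq.
move=> t /mapP[[h d] tL ->]; rewrite mem_enum inE /=.
have [h0 a1 a2 a3] := leL _ tL; have /andP[/= hm dm] := memL _ tL.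
by rewrite !inordK // [(d * _)%N]mulnC !divnK.
Qed.

(** * Totient and harmonic sums *)

Section TotientConvolution.
Variable R : realType.

(** Chosen so that [1 + totient_coeff N p] is the Euler factor at [p] of [[(n,N) = 1] n / phi(n)]:
    zero if [p | N], and [p / (p - 1)] otherwise. *)
Definition totient_coeff (N p : nat) : R :=
  if (p %| N)%N then -1 else (p.-1)%:R^-1.

Lemma totient_ratio (n : nat) : (0 < n)%N ->
  n%:R / (totient n)%:R = \prod_(p <- primes n) (1 + (p.-1)%:R^-1) :> R.
Proof.
move=> n0; rewrite totientE // {1}(prod_prime_decomp n0) prime_decompE big_map /=.
rewrite !natr_prod -prodf_div big_seq [RHS]big_seq; apply: eq_bigr => p.
rewrite mem_primes => /and3P[pp _ pn].
have l0 : (0 < logn p n)%N by rewrite logn_gt0 mem_primes pp n0.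
have p1 := prime_gt1 pp.
case: (logn p n) l0 => // l _ /=; rewrite expnS !natrM natrX invfM mulrACA.
rewrite divff ?mulr1; last by rewrite expf_neq0 // pnatr_eq0; lia.
case: p p1 {pp pn} => [//|[//|p _]] /=.
by rewrite -[in LHS](natr1 p.+1) mulrDl divff ?mul1r // pnatr_eq0.
Qed.

(** Both sides are Euler products over the primes of [n]. A prime common to [n] and [N] makes a
    factor vanish on the right. *)
Lemma coprime_totient_ratio (N n : nat) : (0 < n)%N ->
  (coprime n N)%:R * (n%:R / (totient n)%:R)
  = \sum_(d <- divisors n) sqf_mult (totient_coeff N) d.
Proof.
move=> n0; rewrite sum_divisors_sqf_mult // totient_ratio //.
case: (boolP (coprime n N)) => cnN.
  rewrite mul1r big_seq [RHS]big_seq; apply: eq_bigr => p.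
  rewrite mem_primes /totient_coeff => /and3P[pp _ pn].
  by rewrite -[(p %| N)%N]negbK -prime_coprime // (coprime_dvdl pn cnN).
rewrite mul0r; apply/esym/eqP; rewrite prodf_seq_eq0; apply/hasP.
have g0 : (0 < gcdn n N)%N by rewrite gcdn_gt0 n0.
have g1 : (1 < gcdn n N)%N by move: cnN; rewrite /coprime; lia.
exists (pdiv (gcdn n N)).
  rewrite mem_primes pdiv_prime // n0 /=.
  exact: dvdn_trans (pdiv_dvd _) (dvdn_gcdl _ _).
by rewrite /totient_coeff (dvdn_trans (pdiv_dvd _) (dvdn_gcdr _ _)) subrr eqxx.
Qed.

(** For squarefree [d], the primes dividing [N] contribute absolute value 1, and the others are
    exactly the primes of [f = d / (d,N)], whose factors [1 / (p - 1)] multiply to [1 / phi(f)]. *)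
Lemma norm_totient_coeff_le (N d : nat) : (0 < d)%N ->
  `|sqf_mult (totient_coeff N) d| <= (totient (d %/ gcdn d N))%:R^-1.
Proof.
move=> d0; rewrite /sqf_mult; case: ifP => sd; last first.
  by rewrite normr0 invr_ge0.
have sqd := elimT (squarefreeP d0) sd.
set f := (d %/ gcdn d N)%N.
have dE : d = (gcdn d N * f)%N by rewrite mulnC divnK // dvdn_gcdl.
have f0 : (0 < f)%N by move: d0; rewrite {1}dE muln_gt0 => /andP[].
have fd : (f %| d)%N by rewrite dE dvdn_mull.
have pf : perm_eq (primes f) [seq p <- primes d | ~~ (p %| N)%N].
  apply: uniq_perm => [||p]; rewrite ?filter_uniq ?primes_uniq //.
  rewrite mem_filter !mem_primes f0 d0 /=.
  case pp: (prime p); rewrite /= ?andbF //.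
  apply/idP/andP => [pf|[pN pd]].
    split; last exact: dvdn_trans pf fd.
    apply/negP => pN; have /negP := sqd _ pp; apply.
    rewrite dE expnS expn1; apply: dvdn_mul => //.
    by rewrite dvdn_gcd pN andbT; exact: dvdn_trans pf fd.
  move: pd; rewrite {1}dE Euclid_dvdM // => /orP[|//].
  by rewrite dvdn_gcd (negbTE pN) andbF.
rewrite totientE // (perm_big _ pf) big_filter natr_prod normr_prod -prodfV.
rewrite (bigID (fun p => (p %| N)%N)) /= [X in X * _]big1 ?mul1r; last first.
  by move=> p pN; rewrite /totient_coeff pN normrN1.
rewrite big_seq_cond [X in _ <= X]big_seq_cond; apply: ler_prod => p.
rewrite mem_primes => /andP[/and3P[pp _ pd] pN]; rewrite normr_ge0 /=.
rewrite /totient_coeff (negbTE pN) ger0_norm ?invr_ge0 //.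
(* As [f] divides the squarefree [d], the prime-power part of the totient formula is trivial. *)
suff -> : (logn p f).-1 = 0%N by rewrite expn0 muln1.
suff: ~~ (1 < logn p f)%N by lia.
rewrite -pfactor_dvdn //; apply: contra (sqd _ pp) => /dvdn_trans; exact.
Qed.

(** Telescoping of [1 / (t + 1)^2 <= 1 / t - 1 / (t + 1)]; the induction on [B] is run on the
    sharper bound [1 / m - 1 / B]. *)
Lemma sum_inv_sq_tail (m B : nat) : (0 < m)%N ->
  \sum_(m.+1 <= s < B.+1) (s%:R ^- 2) <= m%:R^-1 :> R.
Proof.
move=> m0; have [Bm|mB] := leqP B m.
  by rewrite big_geq ?invr_ge0 // ltnS.
suff: \sum_(m.+1 <= s < B.+1) (s%:R ^- 2) <= m%:R^-1 - B%:R^-1 :> R.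
  by move/le_trans; apply; rewrite lerBlDr lerDl invr_ge0.
elim: B mB => // B IH; rewrite ltnS leq_eqVlt => /predU1P[<-|mB].
  rewrite big_nat1; have : (0 : R) < m%:R by rewrite ltr0n.
  rewrite -natr1; move: (m%:R) => t t0.
  have -> : t^-1 - (t + 1)^-1 = (t * (t + 1))^-1.
    by field; apply/andP; split; rewrite gt_eqF //; lra.
  by rewrite lef_pV2 ?posrE; nra.
rewrite big_nat_recr /=; last lia.
apply: le_trans (lerD (IH mB) (lexx _)) _.
have : (0 : R) < B%:R by rewrite ltr0n; lia.
rewrite -natr1; move: (B%:R) => t t0.
suff: (t + 1) ^- 2 <= t^-1 - (t + 1)^-1 by lra.
have -> : t^-1 - (t + 1)^-1 = (t * (t + 1))^-1.
  by field; apply/andP; split; rewrite gt_eqF //; lra.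
by rewrite lef_pV2 ?posrE; nra.
Qed.

Lemma sum_inv_sq (B : nat) : \sum_(1 <= s < B.+1) (s%:R ^- 2) <= 2 :> R.
Proof.
case: B => [|B]; first by rewrite big_geq.
rewrite big_ltn // expr1n invr1; have := @sum_inv_sq_tail 1 B.+1 isT.
by rewrite invr1; lra.
Qed.

Lemma totient_ratio_le (n : nat) : (0 < n)%N ->
  n%:R / (totient n)%:R <= \sum_(d <- divisors n) (totient d)%:R^-1 :> R.
Proof.
move=> n0; have := coprime_totient_ratio 1 n0; rewrite coprimen1 mul1r => ->.
rewrite big_seq [leRHS]big_seq; apply: ler_sum => d.
rewrite -dvdn_divisors // => dn; apply: le_trans (ler_norm _) _.
by have := norm_totient_coeff_le 1 (dvdn_gt0 n0 dn); rewrite gcdn1 divn1.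
Qed.

Lemma sum_nat_widen (F : nat -> R) (m n : nat) : (m <= n)%N ->
  (forall i, 0 <= F i) ->
  \sum_(1 <= i < m.+1) F i <= \sum_(1 <= i < n.+1) F i.
Proof.
move=> mn F0; rewrite [leRHS](big_cat_nat _ (n := m.+1)) //=.
by rewrite lerDl sumr_ge0.
Qed.

Lemma sum_totient_conv_le (B : nat) (k : nat -> R) :
  (forall n, 0 <= k n) ->
  \sum_(1 <= n < B.+1) k n / (totient n)%:R
  <= \sum_(1 <= d < B.+1) (totient d)%:R^-1
       * \sum_(1 <= s < (B %/ d).+1) k (d * s)%N / (d * s)%:R.
Proof.
move=> k0.
have := sum_convolution B (fun r => k r / r%:R : R) (fun d => (totient d)%:R^-1 : R).
move=> /= <-; rewrite big_nat [leRHS]big_nat; apply: ler_sum => n /andP[n1 _].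
have -> : k n / (totient n)%:R = (k n / n%:R) * (n%:R / (totient n)%:R).
  by rewrite mulrA divfK // pnatr_eq0; lia.
by apply: ler_wpM2l; [rewrite divr_ge0|exact: totient_ratio_le].
Qed.

(** The convolution bound with [k n = 1 / n]: after dropping [1 / phi(d) <= 1], two sums of inverse
    squares remain, each at most 2. *)
Lemma sum_inv_mul_totient (B : nat) :
  \sum_(1 <= d < B.+1) (d%:R * (totient d)%:R)^-1 <= 4 :> R.
Proof.
have := @sum_totient_conv_le B (fun n => n%:R^-1) (fun n => _).
under eq_bigr do rewrite -invfM.
move=> /(_ ltac:(by move=> n; rewrite invr_ge0)) /le_trans; apply.
apply: (@le_trans _ _ (\sum_(1 <= d < B.+1) (d%:R ^- 2 * 2))); last first.
  by rewrite -mulr_suml; have := sum_inv_sq B; lra.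
rewrite big_nat [leRHS]big_nat; apply: ler_sum => d /andP[d1 _].
have d0 : (0 : R) < d%:R by rewrite ltr0n.
have t1 : (totient d)%:R^-1 <= 1 :> R.
  by rewrite invf_le1 ?ler1n ?ltr0n ?totient_gt0.
under eq_bigr => s _ do rewrite natrM -invfM -expr2 exprMn invfM.
rewrite -mulr_sumr mulrCA; apply: ler_wpM2l; first by rewrite invr_ge0 exprn_ge0 // ltW.
apply: le_trans (sum_inv_sq (B %/ d)).
by rewrite ler_piMl // sumr_ge0 // => i _; rewrite invr_ge0 exprn_ge0.
Qed.

(** Monotonicity of [k] under multiples separates the sums over [d] and [s]; the constant 4 bounds
    the sum of [1 / (d phi(d))]. *)
Lemma sum_div_totient_le (B : nat) (k : nat -> R) :
  (forall n, 0 <= k n) -> (forall d n, (0 < d)%N -> k (d * n)%N <= k n) ->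
  \sum_(1 <= n < B.+1) k n / (totient n)%:R
  <= 4 * \sum_(1 <= s < B.+1) k s / s%:R.
Proof.
move=> k0 kM; apply: le_trans (sum_totient_conv_le _ k0) _.
have S0 : 0 <= \sum_(1 <= s < B.+1) k s / s%:R.
  by apply: sumr_ge0 => i _; rewrite divr_ge0.
apply: le_trans (ler_wpM2r S0 (sum_inv_mul_totient B)).
rewrite mulr_suml big_nat [leRHS]big_nat; apply: ler_sum => d /andP[d1 _].
rewrite [(_ * (totient _)%:R)^-1]invfM [in leRHS]mulrAC [leRHS]mulrC ler_wpM2l ?invr_ge0 //.
have kd0 i : 0 <= k i / i%:R by rewrite divr_ge0.
apply: le_trans (_ : d%:R^-1 * \sum_(1 <= s < (B %/ d).+1) k s / s%:R <= _); last first.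
  by rewrite ler_wpM2l ?invr_ge0 // sum_nat_widen // leq_div.
rewrite mulr_sumr; apply: ler_sum => s _.
rewrite natrM invfM mulrCA ler_wpM2l ?invr_ge0 //.
by rewrite ler_wpM2r ?invr_ge0 // kM.
Qed.

(** Write [d = e f] with [e = (d,N)]. Then [|G_N(d)| <= 1 / phi(f)] and [k d <= k f], and [e] has at
    most [tau N] values. *)
Lemma sum_norm_totient_coeff_le (N B : nat) (k : nat -> R) : (0 < N)%N ->
  (forall n, 0 <= k n) -> (forall d n, (0 < d)%N -> k (d * n)%N <= k n) ->
  \sum_(1 <= d < B.+1) `|sqf_mult (totient_coeff N) d| * k d
  <= (tau N)%:R * \sum_(1 <= f < B.+1) k f / (totient f)%:R.
Proof.
move=> N0 k0 kM.
pose u f := k f / (totient f)%:R.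
have u0 f : 0 <= u f by rewrite divr_ge0.
(* The single term [e = (d,N)] is enlarged to a sum of nonnegative terms over all common divisors
   [e] of [d] and [N], so that the sums can be exchanged. *)
apply: (@le_trans _ _ (\sum_(1 <= d < B.+1)
    \sum_(e <- divisors N | (e %| d)%N) u (d %/ e)%N)).
  rewrite big_nat [leRHS]big_nat; apply: ler_sum => d /andP[d1 _].
  have gN : gcdn d N \in divisors N by rewrite -dvdn_divisors // dvdn_gcdr.
  rewrite [leRHS]big_mkcond (bigD1_seq _ gN) ?divisors_uniq //= dvdn_gcdl.
  rewrite -[leLHS]addr0; apply: lerD; last by apply: sumr_ge0 => e _; case: ifP.
  rewrite mulrC; apply: ler_pM => //; last exact: norm_totient_coeff_le.
  rewrite -{1}(divnK (dvdn_gcdl d N)) mulnC; apply: kM.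
  by rewrite gcdn_gt0 N0 orbT.
rewrite (exchange_big_dep xpredT) //=.
apply: (@le_trans _ _ (\sum_(e <- divisors N) \sum_(1 <= f < B.+1) u f)).
  rewrite big_seq [leRHS]big_seq; apply: ler_sum => e.
  rewrite -dvdn_divisors // => eN; have e0 := dvdn_gt0 N0 eN.
  rewrite sum_multiples //; under eq_bigr do rewrite mulKn //.
  by rewrite sum_nat_widen // leq_div.
by rewrite big_const_seq count_predT iter_addr_0 mulr_natl.
Qed.

End TotientConvolution.

(** * Harmonic sums over dyadic ranges *)

Section HarmonicSums.
Variable R : realType.

(** Covers [s <= t] and [s < t] at once: the value of [p] at an integer equal to [t] is left free.
    The two dyadic ranges to be compared are closed at opposite ends. *)
Definition cut_at (t : R) (p : pred nat) : Prop :=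
  (forall s, p s -> s%:R <= t) /\ (forall s, ~~ p s -> t <= s%:R).

Lemma cut_at_down (t : R) (p : pred nat) : cut_at t p ->
  forall s s', (s <= s')%N -> p s' -> p s.
Proof.
move=> [pt tp] s s'; rewrite leq_eqVlt => /predU1P[->//|ss'] /pt s't.
apply: contraT => /tp ts; have : (s%:R : R) < s'%:R by rewrite ltr_nat.
by move: (le_trans s't ts); lra.
Qed.

Lemma down_threshold (p : pred nat) (T : nat) :
  (forall s s', (s <= s')%N -> p s' -> p s) ->
  exists2 Z, (Z <= T)%N & forall s, (0 < s <= T)%N -> p s = (s <= Z)%N.
Proof.
move=> dp; elim: T => [|T [Z ZT HZ]]; first by exists 0%N => // s; lia.
case: (boolP (p T.+1)) => pT.
  by exists T.+1 => // s /andP[_ sT]; rewrite sT (dp _ _ sT pT).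
exists Z => [|s /andP[s0]]; first lia.
rewrite leq_eqVlt => /predU1P[->|sT]; last by apply: HZ; lia.
by rewrite (negbTE pT); lia.
Qed.

Lemma sum_threshold (p : pred nat) (T Z : nat) (F : nat -> R) : (Z <= T)%N ->
  (forall s, (0 < s <= T)%N -> p s = (s <= Z)%N) ->
  \sum_(1 <= s < T.+1) (p s)%:R * F s = \sum_(1 <= s < Z.+1) F s.
Proof.
move=> ZT HZ; rewrite (big_cat_nat _ (n := Z.+1)) //=.
rewrite [X in _ + X]big1_seq ?addr0; last first.
  move=> s; rewrite mem_index_iota => /andP[Zs sT].
  have -> : p s = false by rewrite HZ; lia.
  by rewrite mul0r.
rewrite big_nat [RHS]big_nat; apply: eq_bigr => s /andP[s1 sZ].
have -> : p s = true by rewrite HZ; lia.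
by rewrite mul1r.
Qed.

Lemma ln_le_sub1 (t : R) : 0 < t -> ln t <= t - 1.
Proof.
by move=> t0; have := @le_ln1Dx R (t - 1); rewrite [1 + _]addrC subrK; apply; lra.
Qed.

(** Both bounds telescope from [1 / (t + 1) <= ln ((t + 1) / t) <= 1 / t]; the upper one shifts the
    range by one, which costs [1 / A - 1 / B]. *)
Lemma sum_inv_bounds (A B : nat) : (0 < A <= B)%N ->
  (ln B%:R - ln A%:R <= \sum_(A <= s < B) s%:R^-1 :> R) /\
  \sum_(A <= s < B) s%:R^-1 <= ln B%:R - ln A%:R + A%:R^-1 - B%:R^-1 :> R.
Proof.
case/andP=> A0; elim: B => [|B IH]; first by lia.
rewrite leq_eqVlt => /predU1P[<-|AB]; first by rewrite big_geq //; lra.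
have [] := IH AB; rewrite big_nat_recr /=; last lia.
have B0 : (0 : R) < B%:R by rewrite ltr0n; lia.
rewrite -natr1; move: (B%:R) B0 => t t0.
have := @ln_le_sub1 ((t + 1) / t); have := @ln_le_sub1 (t / (t + 1)).
rewrite !ln_div ?posrE ?divr_gt0; try lra.
have -> : (t + 1) / t - 1 = t^-1 by field; rewrite gt_eqF.
have -> : t / (t + 1) - 1 = - (t + 1)^-1 by field; rewrite gt_eqF //; lra.
by move=> /(_ isT) h1 /(_ isT) h2; lra.
Qed.

Lemma harmonic_le (J : nat) : (0 < J)%N ->
  \sum_(1 <= j < J.+1) j%:R^-1 <= 1 + ln J%:R :> R.
Proof.
move=> J0; rewrite big_nat_recr //=.
have [_] := @sum_inv_bounds 1 J J0; rewrite ln1 invr1; lra.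
Qed.

(** The sum is [ln (B / A)] up to [1 / A], and [B / A] is 2 up to a relative error [O(1 / Y)]. For
    the trivial bound, at most [A + 1 <= 2 A] terms are each at most [1 / A]. *)
Lemma dyadic_harmonic_nat (Y : R) (A B : nat) : 0 < Y -> (0 < A <= B)%N ->
  Y <= A%:R <= Y + 1 -> 2 * Y <= B%:R <= 2 * Y + 1 ->
  `|\sum_(A <= s < B) s%:R^-1 - ln 2| <= 2 / Y /\
  0 <= \sum_(A <= s < B) (s%:R^-1 : R) <= 2.
Proof.
move=> Y0 AB /andP[YA AY] /andP[YB BY]; have [lo hi] := sum_inv_bounds AB.
have A1 : (1 : R) <= A%:R by rewrite ler1n; lia.
have B1 : (1 : R) <= B%:R by rewrite ler1n; lia.
split.
  have iA : (A%:R : R)^-1 <= Y^-1 by rewrite lef_pV2 ?posrE; lra.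
  have iB : 0 <= (B%:R : R)^-1 by rewrite invr_ge0.
  have h1 : ln (B%:R / (2 * A%:R)) <= Y^-1 :> R.
    apply: le_trans (ln_le_sub1 _) _; first by rewrite divr_gt0; lra.
    rewrite lerBlDr ler_pdivrMr; last lra.
    have -> : (Y^-1 + 1) * (2 * A%:R) = 2 * A%:R + 2 * (A%:R / Y) :> R by ring.
    have : 1 <= A%:R / Y by rewrite ler_pdivlMr; lra.
    lra.
  have h2 : ln ((2 * A%:R) / B%:R) <= Y^-1 :> R.
    apply: le_trans (ln_le_sub1 _) _; first by rewrite divr_gt0; lra.
    rewrite lerBlDr ler_pdivrMr; last lra.
    have -> : (Y^-1 + 1) * B%:R = B%:R + B%:R / Y :> R by ring.
    have : 2 <= B%:R / Y by rewrite ler_pdivlMr; lra.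
    lra.
  move: h1 h2; rewrite !ln_div ?posrE ?lnM ?posrE; try lra.
  by move=> h1 h2; rewrite ler_norml; apply/andP; split; lra.
apply/andP; split; first by apply: sumr_ge0 => i _; rewrite invr_ge0.
apply: (@le_trans _ _ (\sum_(A <= s < B) A%:R^-1)).
  rewrite big_nat [leRHS]big_nat; apply: ler_sum => s /andP[As _].
  by rewrite lef_pV2 ?posrE ?ltr0n ?ler_nat //; lia.
rewrite sumr_const_nat -[_ *+ _]mulr_natr mulrC ler_pdivrMr; last lra.
by rewrite natrB; [lra|lia].
Qed.

Lemma dyadic_harmonic_cut (Y : R) (p1 p2 : pred nat) (T : nat) : 0 < Y ->
  cut_at Y p1 -> cut_at (2 * Y) p2 -> 2 * Y <= T%:R + 1 ->
  `|\sum_(1 <= s < T.+1) ((p2 s)%:R - (p1 s)%:R) / s%:R - ln 2| <= 2 / Y /\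
  0 <= \sum_(1 <= s < T.+1) (((p2 s)%:R - (p1 s)%:R) / s%:R : R) <= 2.
Proof.
move=> Y0 c1 c2 YT.
have [Z1 Z1T H1] := down_threshold T (cut_at_down c1).
have [Z2 Z2T H2] := down_threshold T (cut_at_down c2).
have Z12 : (Z1 <= Z2)%N.
  case: (posnP Z1) => [->//|Z0].
  have p1Z : p1 Z1 by rewrite H1 ?leqnn // Z0.
  rewrite -H2 ?Z0 //; apply: contraT => /(proj2 c2).
  by have := proj1 c1 _ p1Z; lra.
(* The assumption [t <= T + 1] supplies the lower bound when the threshold [Z] is [T] itself, so
   stopping at [T] loses nothing. *)
have thr t p Z : cut_at t p -> 0 < t -> (Z <= T)%N -> t <= T%:R + 1 ->
    (forall s, (0 < s <= T)%N -> p s = (s <= Z)%N) ->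
    t <= (Z.+1%:R : R) <= t + 1.
  move=> c t0 ZT tT HZ; apply/andP; split.
    move: ZT; rewrite leq_eqVlt => /predU1P[->|ZT]; first by rewrite -natr1.
    by apply: (proj2 c); rewrite HZ ?ltnn //; lia.
  rewrite -natr1 lerD2r; case: (posnP Z) => [->|Z0]; first exact: ltW.
  by apply: (proj1 c); rewrite HZ ?leqnn // Z0.
have -> : \sum_(1 <= s < T.+1) ((p2 s)%:R - (p1 s)%:R) / s%:R
    = \sum_(Z1.+1 <= s < Z2.+1) s%:R^-1 :> R.
  under eq_bigr do rewrite mulrBl.
  rewrite sumrB (sum_threshold _ Z2T H2) (sum_threshold _ Z1T H1).
  by rewrite (big_cat_nat _ (n := Z1.+1)) //= addrC addrK.
apply: dyadic_harmonic_nat => //.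
  by apply: (thr _ _ _ c1) => //; lra.
by apply: (thr _ _ _ c2) => //; lra.
Qed.

(** Split at [s = j]: below, the minimum is [1 / j] and a harmonic sum remains; above, the tail of
    inverse squares is at most [1 / j]. *)
Lemma sum_inv_min (j B : nat) : (0 < j)%N ->
  \sum_(1 <= s < B.+1) Num.min (s%:R^-1) (j%:R^-1) / s%:R
  <= (3 + ln j%:R) / j%:R :> R.
Proof.
move=> j0.
have F0 s : 0 <= Num.min (s%:R^-1) (j%:R^-1) / s%:R :> R.
  by rewrite divr_ge0 // le_min !invr_ge0 !ler0n.
apply: le_trans (sum_nat_widen (leq_maxr j B) F0) _.
have jm : (j <= maxn j B)%N by exact: leq_maxl.
move: (maxn j B) jm => {}B jB.
have j1 : (1 : R) <= j%:R by rewrite ler1n.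
rewrite (big_cat_nat _ (n := j.+1)) //=.
have -> : (3 + ln j%:R) / j%:R = (2 + ln j%:R) / j%:R + j%:R^-1 :> R by ring.
apply: lerD.
  apply: (@le_trans _ _ (j%:R^-1 * \sum_(1 <= s < j.+1) s%:R^-1)).
    rewrite mulr_sumr; apply: ler_sum => s _.
    by rewrite ler_wpM2r ?invr_ge0 // ge_min lexx orbT.
  rewrite mulrC ler_wpM2r ?invr_ge0 //.
  by have := harmonic_le j0; lra.
apply: le_trans (sum_inv_sq_tail R B j0).
rewrite big_nat [leRHS]big_nat; apply: ler_sum => s /andP[js _].
rewrite expr2 invfM ler_wpM2r ?invr_ge0 // ge_min lexx //.
Qed.

End HarmonicSums.

(** * Sums of [[(q,N) = 1] / phi(q)] over dyadic ranges *)

Section CoprimeTotientSums.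
Variable R : realType.

Lemma sum_coprime_totient_conv (N T : nat) (c : nat -> R) :
  \sum_(1 <= q < T.+1) c q * ((coprime q N)%:R / (totient q)%:R)
  = \sum_(1 <= d < T.+1) (sqf_mult (totient_coeff R N) d / d%:R)
      * \sum_(1 <= s < (T %/ d).+1) c (d * s)%N / s%:R.
Proof.
transitivity (\sum_(1 <= q < T.+1) (c q / q%:R)
    * \sum_(d <- divisors q) sqf_mult (totient_coeff R N) d).
  rewrite big_nat [RHS]big_nat; apply: eq_bigr => q /andP[q1 _].
  rewrite -coprime_totient_ratio // -mulrA; congr (_ * _).
  by rewrite mulrCA mulKf // pnatr_eq0; lia.
rewrite (sum_convolution T (fun q => c q / q%:R)).
apply: eq_bigr => d _; rewrite -mulrA mulr_sumr; congr (_ * _).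
by apply: eq_bigr => s _; rewrite natrM invfM; ring.
Qed.

Lemma cut_at_mull (t : R) (p : pred nat) (d : nat) : (0 < d)%N ->
  cut_at t p -> cut_at (t / d%:R) (fun s => p (d * s)%N).
Proof.
move=> d0 [pt tp]; have d0' : (0 : R) < d%:R by rewrite ltr0n.
split=> s.
  by move/pt; rewrite ler_pdivlMr // natrM mulrC.
by move/tp; rewrite ler_pdivrMr // natrM mulrC.
Qed.

Lemma ge_divn_succ (t : R) (T d : nat) : (0 < d)%N -> t <= T%:R + 1 ->
  t / d%:R <= (T %/ d)%:R + 1.
Proof.
move=> d0 tT; rewrite ler_pdivrMr ?ltr0n //; apply: le_trans tT _.
by rewrite !natr1 -natrM ler_nat ltn_ceil.
Qed.

(** For each [d] the inner sum is a dyadic harmonic sum at scale [y / d], at most 2; the sum of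
    [1 / (d phi(d))] is at most 4. *)
Lemma sum_dyadic_totient_le (y : R) (p1 p2 : pred nat) (T : nat) : 0 < y ->
  cut_at y p1 -> cut_at (2 * y) p2 -> 2 * y <= T%:R + 1 ->
  \sum_(1 <= q < T.+1) ((p2 q)%:R - (p1 q)%:R) / (totient q)%:R <= (8 : R).
Proof.
move=> y0 c1 c2 yT.
have p12 q : p1 q -> p2 q.
  move=> /(proj1 c1) qy; apply: contraT => /(proj2 c2); lra.
have k0 q : 0 <= (p2 q)%:R - (p1 q)%:R :> R.
  by case: (boolP (p1 q)) => [/p12 ->|_]; rewrite ?subrr ?subr0.
apply: le_trans (sum_totient_conv_le _ k0) _.
apply: (@le_trans _ _ (2 * \sum_(1 <= d < T.+1) (d%:R * (totient d)%:R)^-1)); last first.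
  by have := sum_inv_mul_totient R T; lra.
rewrite mulr_sumr big_nat [leRHS]big_nat; apply: ler_sum => d /andP[d1 _].
have d0 : (0 : R) < d%:R by rewrite ltr0n.
rewrite invfM mulrA [leRHS]mulrC ler_wpM2l ?invr_ge0 //.
under eq_bigr => s _ do rewrite natrM invfM mulrCA.
rewrite -mulr_sumr mulrC ler_wpM2r ?invr_ge0 //.
have [||||_ /andP[_ le2]] := @dyadic_harmonic_cut R (y / d%:R)
    (fun s => p1 (d * s)%N) (fun s => p2 (d * s)%N) (T %/ d).
- by rewrite divr_gt0.
- exact: cut_at_mull.
- by rewrite mulrA; exact: cut_at_mull.
- by rewrite mulrA; exact: ge_divn_succ.
exact: le2.
Qed.

(* The two dyadic sums share the main term [ln 2 * \sum_d G_N(d) / d], so only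
   the errors of the harmonic sums survive: no asymptotic is needed. *)
Lemma dyadic_totient_compare (N j T : nat) (y y' : R) (p1 p2 p1' p2' : pred nat) :
  (0 < N)%N -> (0 < j)%N -> j%:R / 2 <= y -> y <= y' ->
  cut_at y p1 -> cut_at (2 * y) p2 -> cut_at y' p1' -> cut_at (2 * y') p2' ->
  2 * y' <= T%:R + 1 ->
  `|\sum_(1 <= q < T.+1)
      (((p2 q)%:R - (p1 q)%:R) - ((p2' q)%:R - (p1' q)%:R))
        * ((coprime q N)%:R / (totient q)%:R)|
  <= 32 * (tau N)%:R * ((3 + ln j%:R) / j%:R) :> R.
Proof.
move=> N0 j0 jy yy' c1 c2 c1' c2' yT.
have j0' : (0 : R) < j%:R by rewrite ltr0n.
have y0 : 0 < y by lra.
rewrite sum_coprime_totient_conv.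
(* For each [d] both harmonic sums lie in [[0, 2]] and within [4 d / j] of [ln 2], so they differ by
   at most [8 min(1, d / j) = 8 d (k d)]. The constant 32 is this 8 times the 4 of
   [sum_div_totient_le]. *)
pose k (d : nat) : R := Num.min (d%:R^-1) (j%:R^-1).
have k0 n : 0 <= k n by rewrite le_min !invr_ge0 !ler0n.
have kM d n : (0 < d)%N -> k (d * n)%N <= k n.
  move=> d0; case: (posnP n) => [->|n0]; first by rewrite muln0.
  rewrite /k le_min !ge_min lexx orbT andbT lef_pV2 ?posrE ?ltr0n ?muln_gt0 ?d0 //.
  by rewrite ler_nat leq_pmull.
apply: (@le_trans _ _ (8 * \sum_(1 <= d < T.+1) `|sqf_mult (totient_coeff R N) d| * k d)).
  apply: le_trans (ler_norm_sum _ _ _) _.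
  rewrite mulr_sumr big_nat [leRHS]big_nat; apply: ler_sum => d /andP[d1 _].
  have d0 : (0 : R) < d%:R by rewrite ltr0n.
  rewrite normrM normrM mulrCA -mulrA ler_wpM2l //.
  rewrite gtr0_norm ?invr_gt0 // mulrC ler_pdivrMr //.
  under eq_bigr => s _ do rewrite mulrBl.
  rewrite sumrB.
  have [||||e1 /andP[a1 b1]] := @dyadic_harmonic_cut R (y / d%:R)
    (fun s => p1 (d * s)%N) (fun s => p2 (d * s)%N) (T %/ d).
  - by rewrite divr_gt0.
  - exact: cut_at_mull.
  - by rewrite mulrA; exact: cut_at_mull.
  - by rewrite mulrA; apply: ge_divn_succ => //; lra.
  have [||||e2 /andP[a2 b2]] := @dyadic_harmonic_cut R (y' / d%:R)
    (fun s => p1' (d * s)%N) (fun s => p2' (d * s)%N) (T %/ d).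
  - by rewrite divr_gt0 //; lra.
  - exact: cut_at_mull.
  - by rewrite mulrA; exact: cut_at_mull.
  - by rewrite mulrA; exact: ge_divn_succ.
  have iy : (y / d%:R)^-1 <= 2 * d%:R / j%:R.
    rewrite invf_div ler_pdivrMr // mulrAC ler_pdivlMr //.
    by rewrite mulrAC mulrC ler_pM2r //; lra.
  have iy' : (y' / d%:R)^-1 <= 2 * d%:R / j%:R.
    apply: le_trans iy; rewrite lef_pV2 ?posrE ?divr_gt0 //; last lra.
    by rewrite ler_pM2r ?invr_gt0.
  move: e1 e2 a1 b1 a2 b2; rewrite !ler_norml.
  set S1 := \sum_(1 <= s < _) _; set S2 := \sum_(1 <= s < _) _.
  move=> /andP[e1 f1] /andP[e2 f2] a1 b1 a2 b2.
  rewrite /k minEle; case: ifP => _.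
    by rewrite mulfVK ?gt_eqF //; apply/andP; split; lra.
  have -> : 8 * j%:R^-1 * d%:R = 4 * (2 * d%:R / j%:R) :> R by ring.
  by apply/andP; split; lra.
have h1 := sum_norm_totient_coeff_le T N0 k0 kM.
have h2 := sum_div_totient_le T k0 kM.
have h3 := sum_inv_min R T j0.
have t0 : 0 <= (tau N)%:R :> R by [].
have h4 : \sum_(1 <= f < T.+1) k f / (totient f)%:R <= 4 * ((3 + ln j%:R) / j%:R).
  by apply: le_trans h2 _; rewrite ler_pM2l.
have h5 := ler_wpM2l t0 h4.
by move: h1 h5; rewrite mulrCA; lra.
Qed.

End CoprimeTotientSums.

(** * Comparison of the original and the switched dyadic ranges *)

Section DyadicDifference.
Variables (R : realType) (Q : R).
Hypothesis Q0 : 0 < Q.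

(** For [q > 0] this says that [|m - n| / q], the complementary divisor when [q | m - n], lies in
    [(Q/2, Q]]. *)
Definition dyadic_dist (q m n : nat) : bool :=
  q%:R * Q / 2 < `|m%:R - n%:R| <= q%:R * Q.

Lemma dyadic_dist_mul (h q m n : nat) : (0 < h)%N ->
  dyadic_dist (h * q) (h * m) (h * n) = dyadic_dist q m n.
Proof.
move=> h0; rewrite /dyadic_dist !natrM -mulrBr normrM normr_nat.
by rewrite -!mulrA ltr_pM2l ?ler_pM2l ?ltr0n.
Qed.

(** Here [m], [n] and [q] stand for quotients by a common divisor [h]. By homogeneity the first
    indicator does not involve [h], while the second range becomes [(Q/(2h), Q/h]]. *)
Definition dyadic_diff (h m n : nat) : R :=
  \sum_(1 <= q < (Num.truncn Q %/ h).+1)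
    ((dyadic_dist q m n)%:R - (Q / 2 < (h * q)%:R)%R%:R)
      * ((coprime q (m * n))%:R / (totient q)%:R).

Lemma dyadic_diff_cut (h q : nat) : (0 < h)%N -> (q < (Num.truncn Q %/ h).+1)%N ->
  ((Q / 2 < (h * q)%:R)%R%:R : R) = ((h * q)%:R <= Q)%R%:R - ((h * q)%:R <= Q / 2)%R%:R.
Proof.
move=> h0; rewrite ltnS leq_divRL // mulnC => qT.
have -> : (h * q)%:R <= Q by rewrite -truncn_ge_nat // ltW.
by rewrite ltNge; case: (_ <= _); rewrite ?subrr ?subr0.
Qed.

Lemma cut_at_mul_le (h : nat) (t : R) : (0 < h)%N ->
  cut_at (t / h%:R) (fun q => (h * q)%:R <= t).
Proof.
move=> h0; have h0' : (0 : R) < h%:R by rewrite ltr0n.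
split=> s; first by rewrite natrM mulrC ler_pdivlMr.
by rewrite -ltNge natrM mulrC ler_pdivrMr // => /ltW.
Qed.

Lemma cut_at_mul_lt (c t : R) : 0 < c ->
  cut_at (t / c) (fun q => q%:R * c < t).
Proof.
move=> c0; split=> s; first by rewrite ler_pdivlMr // => /ltW.
by rewrite -leNgt ler_pdivrMr.
Qed.

Lemma truncn_div_ge (h : nat) : (0 < h)%N ->
  2 * (Q / 2 / h%:R) <= (Num.truncn Q %/ h)%:R + 1.
Proof.
move=> h0; rewrite mulrA mulrCA divff ?mulr1 //.
apply: ge_divn_succ => //; rewrite natr1; apply: ltW; exact: truncnS_gt.
Qed.

(** When [|m - n| <= Q / 2] the first range contains no [q >= 1], and only the sum over the second
    one remains. *)
Lemma dyadic_diff_near (h m n : nat) : (0 < h)%N ->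
  `|m%:R - n%:R| <= Q / 2 -> `|dyadic_diff h m n| <= 8.
Proof.
move=> h0 near.
apply: le_trans (ler_norm_sum _ _ _) _.
apply: le_trans (@sum_dyadic_totient_le R (Q / 2 / h%:R)
    (fun q => (h * q)%:R <= Q / 2) (fun q => (h * q)%:R <= Q)
    (Num.truncn Q %/ h) _ _ _ _); last 4 first.
- by rewrite !divr_gt0 ?ltr0n.
- exact: cut_at_mul_le.
- by rewrite mulrA mulrCA divff ?mulr1 //; exact: cut_at_mul_le.
- exact: truncn_div_ge.
rewrite big_nat [leRHS]big_nat; apply: ler_sum => q /andP[q1 qT].
rewrite -dyadic_diff_cut //.
have -> : dyadic_dist q m n = false.
  apply/negbTE; rewrite negb_and -leNgt; apply/orP; left.
  apply: le_trans near _; rewrite ler_pM2r // ler_peMl ?(ltW Q0) //.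
  by rewrite ler1n.
rewrite sub0r mulNr normrN normrM normr_nat ler_wpM2l //.
by rewrite ger0_norm ?divr_ge0 // ler_piMl ?invr_ge0 //; case: coprime.
Qed.

(** The comparison is applied at the scales [y = |m - n| / Q] and [y' = Q / (2h)]: the lower bound
    on [|m - n|] gives [j / 2 <= y], the upper bound gives [y <= y']. *)
Lemma dyadic_diff_far (h m n j : nat) : (0 < h)%N -> (0 < m)%N -> (0 < n)%N ->
  (0 < j)%N -> j%:R * (Q / 2) <= `|m%:R - n%:R| ->
  h%:R * `|m%:R - n%:R| <= Q ^+ 2 / 2 ->
  `|dyadic_diff h m n| <= 32 * ((tau m)%:R * (tau n)%:R) * ((3 + ln j%:R) / j%:R).
Proof.
move=> h0 m0 n0 j0 far near; have Q2 : Q / 2 <= Q by move: Q0; lra.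
have [k kE] : exists k : R, k = `|m%:R - n%:R| by eexists.
rewrite -kE in far near.
have h0' : (0 : R) < h%:R by rewrite ltr0n.
have := @dyadic_totient_compare R (m * n) j (Num.truncn Q %/ h) (k / Q) (Q / 2 / h%:R)
  (fun q => q%:R * Q < k) (fun q => q%:R * (Q / 2) < k)
  (fun q => (h * q)%:R <= Q / 2) (fun q => (h * q)%:R <= Q).
rewrite muln_gt0 m0 n0 j0 => /(_ isT isT).
have -> : 2 * (k / Q) = k / (Q / 2) by field; rewrite gt_eqF.
have -> : 2 * (Q / 2 / h%:R) = Q / h%:R by field; rewrite gt_eqF.
move=> H.
apply: le_trans (_ : 32 * (tau (m * n))%:R * ((3 + ln j%:R) / j%:R) <= _); last first.
  rewrite ler_wpM2r ?divr_ge0 ?addr_ge0 ?ln_ge0 ?ler1n //.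
  by rewrite ler_pM2l // -natrM ler_nat tau_mul.
apply: le_trans (H _ _ _ _ _ _ _).
- rewrite le_eqVlt; apply/orP; left; apply/eqP; congr `| _ |.
  rewrite /dyadic_diff big_nat [RHS]big_nat; apply: eq_bigr => q /andP[q1 qT].
  rewrite -dyadic_diff_cut //; congr ((_ - _) * _).
  rewrite /dyadic_dist -kE -mulrA.
  case: (ltP (q%:R * (Q / 2)) k) => h2 /=.
    by rewrite leNgt; case: (_ < _); rewrite ?subrr ?subr0.
  have -> : (q%:R * Q < k) = false.
    apply/negbTE; rewrite -leNgt; apply: le_trans h2 _.
    by rewrite ler_wpM2l.
  by rewrite subrr.
- by rewrite ler_pdivlMr //; lra.
- rewrite ler_pdivrMr // mulrAC ler_pdivlMr //; move: near; rewrite expr2; lra.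
- exact: cut_at_mul_lt.
- by apply: cut_at_mul_lt; rewrite divr_gt0.
- exact: cut_at_mul_le.
- exact: cut_at_mul_le.
- by have := truncn_div_ge h0; rewrite mulrA mulrCA divff ?mulr1.
Qed.

End DyadicDifference.

(** * The variance kernel and divisor switching *)

Section ProgressionKernel.
Variable R : realType.
Implicit Types b : nat -> R.

Definition gcd_weight (q m n : nat) : R :=
  (gcdn m q == gcdn n q)%:R / (totient (q %/ gcdn m q))%:R.

(* [\sum_(m <= z) b m * prog_kernel q m c] is the discrepancy of the sequence [b]
   in the class of [c] modulo [q]. *)
Definition prog_kernel (q m n : nat) : R :=
  (m == n %[mod q])%N%:R - gcd_weight q m n.

Lemma gcd_weightC (q m n : nat) : gcd_weight q m n = gcd_weight q n m.
Proof.
rewrite /gcd_weight eq_sym; case: eqP => [->//|_]; by rewrite !mul0r.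
Qed.

Lemma gcdn_eqmod (q m n : nat) : (m = n %[mod q])%N -> gcdn m q = gcdn n q.
Proof. by move=> mn; rewrite -gcdn_modl mn gcdn_modl. Qed.

Lemma gcd_weight_eqmod (q m n n' : nat) : (n = n' %[mod q])%N ->
  gcd_weight q m n = gcd_weight q m n'.
Proof. by move=> /gcdn_eqmod nn'; rewrite /gcd_weight nn'. Qed.

Lemma prog_kernel_eqmod (q m n n' : nat) : (n = n' %[mod q])%N ->
  prog_kernel q m n = prog_kernel q m n'.
Proof. by move=> nn'; rewrite /prog_kernel (gcd_weight_eqmod _ nn') nn'. Qed.

Lemma eqmod_range (q c c' : nat) : (0 < c <= q)%N -> (0 < c' <= q)%N ->
  (c == c' %[mod q])%N -> c = c'.
Proof.
case: c => // c; case: c' => // c' /= cq c'q.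
by rewrite -(addn1 c) -(addn1 c') eqn_modDr !modn_small // => /eqP ->.
Qed.

Lemma sum_residue (q m : nat) (F : nat -> R) : (0 < q)%N ->
  (forall c, (c = m %[mod q])%N -> F c = F m) ->
  \sum_(1 <= c < q.+1) (m == c %[mod q])%N%:R * F c = F m.
Proof.
(* Representatives run over [1 .. q], so the zero class is represented by [q]. *)
move=> q0 Fm; pose c0 := if (q %| m)%N then q else (m %% q)%N.
have c0q : (0 < c0 <= q)%N.
  rewrite /c0; case: ifP => [_|/negbT]; first by rewrite q0 leqnn.
  by rewrite /dvdn -lt0n => -> /=; rewrite ltnW // ltn_pmod.
have c0m : (c0 = m %[mod q])%N.
  by rewrite /c0; case: ifP => [/eqP ->|_]; rewrite ?modnn ?modn_mod.
have c0i : c0 \in index_iota 1 q.+1 by rewrite mem_index_iota ltnS.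
rewrite (bigD1_seq _ c0i) ?iota_uniq //= c0m eqxx mul1r (Fm _ c0m).
rewrite big1_seq ?addr0 // => c /andP[cc0]; rewrite mem_index_iota ltnS => cq.
case: (boolP (m == c %[mod q])%N) => [mc|_]; last by rewrite mul0r.
case/eqP: cc0; apply: (eqmod_range cq c0q).
by rewrite c0m eq_sym.
Qed.

(** As an operator on residues modulo [q] the kernel is [I - P], where [P] averages over the
    residues having the same gcd with [q]. Since [P] is a symmetric projection, so is [I - P]. *)
Lemma prog_kernel_proj (q m n : nat) : (0 < q)%N ->
  \sum_(1 <= c < q.+1) prog_kernel q m c * prog_kernel q n c = prog_kernel q m n.
Proof.
move=> q0.
(* Expansion of [(I - P)^2]: both cross terms are [P], and the last sum is [P^2 = P]. *)
have -> : \sum_(1 <= c < q.+1) prog_kernel q m c * prog_kernel q n c =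
    \sum_(1 <= c < q.+1) (m == c %[mod q])%N%:R * (n == c %[mod q])%N%:R
  - \sum_(1 <= c < q.+1) (m == c %[mod q])%N%:R * gcd_weight q n c
  - \sum_(1 <= c < q.+1) (n == c %[mod q])%N%:R * gcd_weight q m c
  + \sum_(1 <= c < q.+1) gcd_weight q m c * gcd_weight q n c.
  by rewrite -!sumrB -big_split /=; apply: eq_bigr => c _; rewrite /prog_kernel; ring.
rewrite !(sum_residue q0); try by move=> c cm; rewrite ?cm // (gcd_weight_eqmod _ cm).
have -> : \sum_(1 <= c < q.+1) gcd_weight q m c * gcd_weight q n c = gcd_weight q m n.
  transitivity (gcd_weight q m n * (totient (q %/ gcdn m q))%:R^-1
      * (\sum_(1 <= c < q.+1) (gcdn c q == gcdn m q))%N%:R).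
    rewrite natr_sum mulr_sumr; apply: eq_bigr => c _; rewrite /gcd_weight.
    rewrite [gcdn c q == _]eq_sym.
    have [gc|_] := eqVneq (gcdn m q) (gcdn c q); last by rewrite mulr0 !mul0r.
    rewrite gc [gcdn n q == _]eq_sym; have [gn|_] := eqVneq (gcdn c q) (gcdn n q).
      by rewrite gn mulr1 mul1r.
    by rewrite !mul0r mulr0.
  rewrite sum_gcd_totient ?dvdn_gcdr // divfK // pnatr_eq0 -lt0n totient_gt0.
  by rewrite divn_gt0 ?gcdn_gt0 ?q0 ?orbT // dvdn_leq // dvdn_gcdr.
by rewrite /prog_kernel [gcd_weight q n m]gcd_weightC eq_sym; ring.
Qed.

Lemma sum_sq_prog_kernel b (X q : nat) : (0 < q)%N ->
  \sum_(1 <= c < q.+1) (\sum_(1 <= m < X.+1) b m * prog_kernel q m c) ^+ 2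
  = \sum_(1 <= m < X.+1) \sum_(1 <= n < X.+1) b m * b n * prog_kernel q m n.
Proof.
move=> q0; under eq_bigr => c _ do rewrite expr2 mulr_suml.
rewrite exchange_big /=; apply: eq_bigr => m _.
under eq_bigr => c _ do rewrite mulr_sumr.
rewrite exchange_big /=; apply: eq_bigr => n _.
rewrite -prog_kernel_proj // mulr_sumr; apply: eq_bigr => c _; ring.
Qed.

Lemma prog_sub_average b (X q c : nat) : (0 < q)%N ->
  \sum_(1 <= n < X.+1 | (n == c %[mod q])%N) b n
  - (totient (q %/ gcdn c q))%:R^-1 *
    \sum_(1 <= c' < q.+1 | gcdn c' q == gcdn c q)
      \sum_(1 <= n < X.+1 | (n == c' %[mod q])%N) b n
  = \sum_(1 <= m < X.+1) b m * prog_kernel q m c.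
Proof.
move=> q0; rewrite /prog_kernel; under [RHS]eq_bigr do rewrite mulrBr.
rewrite sumrB; congr (_ - _).
  by rewrite big_mkcond; apply: eq_bigr => n _; case: eqP; rewrite ?mulr1 ?mulr0.
rewrite big_mkcond /=.
transitivity ((totient (q %/ gcdn c q))%:R^-1 * \sum_(1 <= n < X.+1) b n
    * \sum_(1 <= c' < q.+1) (n == c' %[mod q])%N%:R * (gcdn c' q == gcdn c q)%:R).
  congr (_ * _); under [RHS]eq_bigr do rewrite mulr_sumr.
  rewrite [RHS]exchange_big /=; apply: eq_bigr => c' _.
  case: eqP => _; last by rewrite big1 // => n _; rewrite !mulr0.
  rewrite big_mkcond; apply: eq_bigr => n _.
  by case: eqP => _; rewrite mulr1 ?mulr0 ?mulr1.
rewrite mulr_sumr; apply: eq_bigr => n _; rewrite sum_residue //; last first.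
  by move=> c' c'n; rewrite (gcdn_eqmod c'n).
rewrite /gcd_weight; case: (eqVneq (gcdn n q) (gcdn c q)) => [->|_].
  by rewrite mulr1 mul1r mulrC.
by rewrite !(mulr0, mul0r).
Qed.

Lemma coprime_div_gcd (h q m : nat) : (0 < h)%N -> (h %| q)%N -> (h %| m)%N ->
  coprime (q %/ h) (m %/ h) = (gcdn m q == h).
Proof.
move=> h0 /dvdnP[q' ->] /dvdnP[m' ->]; rewrite !mulnK // -muln_gcdl.
by rewrite -{2}[h]mul1n eqn_pmul2r // gcdnC.
Qed.

(** When [h] divides [q], [m] and [n], coprimality of [q / h] with [(m / h)(n / h)] means
    [h = (m,q) = (n,q)], so at most one [h] contributes. *)
Lemma gcd_weight_sum (q m n B : nat) : (0 < q <= B)%N ->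
  gcd_weight q m n = \sum_(1 <= h < B.+1 | (h %| q)%N)
    ((h %| m)%N && (h %| n)%N)%:R
      * ((coprime (q %/ h) ((m %/ h) * (n %/ h)))%:R / (totient (q %/ h))%:R).
Proof.
case/andP=> q0 qB.
transitivity (\sum_(1 <= h < B.+1 | (h %| q)%N)
  ((gcdn m q == h) && (gcdn n q == h))%:R / (totient (q %/ h))%:R : R); last first.
  rewrite big_nat_cond [RHS]big_nat_cond; apply: eq_bigr => h /andP[/andP[h0 _] hq].
  rewrite mulrA; congr (_ / _).
  case: (boolP ((h %| m) && (h %| n))%N) => [/andP[hm hn]|hmn].
    by rewrite mul1r coprimeMr !coprime_div_gcd.
  rewrite mul0r; case: (boolP (_ && _)) => // /andP[/eqP gm /eqP gn].
  by case/negP: hmn; rewrite -{1}gm -gn !dvdn_gcdl.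
have gB : gcdn m q \in index_iota 1 B.+1.
  rewrite mem_index_iota gcdn_gt0 q0 orbT ltnS.
  exact: leq_trans (dvdn_leq q0 (dvdn_gcdr _ _)) qB.
rewrite big_mkcond (bigD1_seq _ gB) ?iota_uniq //= dvdn_gcdr eqxx /=.
rewrite big1 ?addr0 => [|h /negbTE hg]; first by rewrite /gcd_weight eq_sym.
by rewrite [gcdn m q == h]eq_sym hg /= mul0r; case: ifP.
Qed.

Lemma sum_gcd_weight (T m n : nat) (u : nat -> R) :
  \sum_(1 <= q < T.+1) u q * gcd_weight q m n
  = \sum_(1 <= h < T.+1) ((h %| m)%N && (h %| n)%N)%:R *
      \sum_(1 <= s < (T %/ h).+1) u (h * s)%N
        * ((coprime s ((m %/ h) * (n %/ h)))%:R / (totient s)%:R).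
Proof.
transitivity (\sum_(1 <= q < T.+1) \sum_(1 <= h < T.+1 | (h %| q)%N)
    u q * (((h %| m)%N && (h %| n)%N)%:R
      * ((coprime (q %/ h) ((m %/ h) * (n %/ h)))%:R / (totient (q %/ h))%:R))).
  rewrite big_nat [RHS]big_nat; apply: eq_bigr => q qT.
  by rewrite (gcd_weight_sum _ _ qT) mulr_sumr.
under eq_bigr do rewrite big_mkcond.
rewrite exchange_big /= big_nat [RHS]big_nat; apply: eq_bigr => h /andP[h0 _].
rewrite -big_mkcond sum_multiples // mulr_sumr; apply: eq_bigr => s _.
by rewrite mulKn // mulrCA.
Qed.

End ProgressionKernel.

(** * Divisor switching and windows of initial segments *)

Section Switching.
Variable R : realType.
Implicit Types (Q x : R) (b al : nat -> R).

Lemma dyadic_dist_diag Q (r n : nat) : 0 < Q -> (0 < r)%N ->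
  dyadic_dist Q r n n = false.
Proof.
move=> Q0 r0; rewrite /dyadic_dist subrr normr0; apply/negbTE.
by rewrite negb_and -leNgt !mulr_ge0 // ltW.
Qed.

Lemma dyadic_distC Q (r m n : nat) : dyadic_dist Q r m n = dyadic_dist Q r n m.
Proof. by rewrite /dyadic_dist distrC. Qed.

(** The diagonal [m = n] gives the first term. Off it, with [k = |m - n|], the map [q -> k / q] is a
    bijection between the divisors of [k] in [(Q/2, Q]] and those satisfying [dyadic_dist]. *)
Lemma divisor_switch Q (m n : nat) : 0 < Q -> `|m%:R - n%:R| <= Q ^+ 2 / 2 ->
  \sum_(1 <= q < (Num.truncn Q).+1) (Q / 2 < q%:R)%R%:R * (m == n %[mod q])%N%:R
  = (\sum_(1 <= q < (Num.truncn Q).+1) (Q / 2 < q%:R)%R%:R) * (m == n)%:R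
    + \sum_(1 <= r < (Num.truncn Q).+1)
        (dyadic_dist Q r m n)%:R * (m == n %[mod r])%N%:R :> R.
Proof.
move=> Q0; wlog nm : m n / (n <= m)%N => [hw|].
  case: (leqP n m) => [|/ltnW] nm mnQ; first exact: hw.
  rewrite distrC in mnQ; have := hw _ _ nm mnQ.
  under eq_bigr do rewrite eq_sym.
  move=> ->; rewrite eq_sym; congr (_ + _).
  by apply: eq_bigr => r _; rewrite dyadic_distC eq_sym.
have [->|mNn] := eqVneq m n.
  move=> _; rewrite mulr1 [X in _ + X]big1_seq ?addr0; last first.
    by move=> r; rewrite mem_index_iota => /= /andP[r0 _]; rewrite dyadic_dist_diag ?mul0r.
  by apply: eq_bigr => q _; rewrite eqxx mulr1.
rewrite -natrB // ger0_norm // mulr0 add0r => kQ.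
have k0 : (0 < m - n)%N by rewrite subn_gt0 ltn_neqAle eq_sym mNn.
have dE r : dyadic_dist Q r m n
    = (r%:R * Q / 2 < (m - n)%:R) && ((m - n)%:R <= r%:R * Q).
  by rewrite /dyadic_dist -natrB // ger0_norm.
move: (m - n)%N kQ k0 dE (fun q => eqn_mod_dvd q nm) => k kQ k0 dE modE.
under eq_bigr => q _ do rewrite modE -natrM mulnb.
under [RHS]eq_bigr => r _ do rewrite modE -natrM mulnb dE.
have sum_count (p : pred nat) s : (\sum_(i <- s) p i)%N = size (seq.filter p s).
  by rewrite size_filter -sum1_count [RHS]big_mkcond; apply: eq_bigr => i _; case: (p i).
rewrite -!natr_sum !sum_count; congr (_%:R).
set L1 := seq.filter _ _; set L2 := seq.filter _ _.
rewrite -(size_map (fun q => (k %/ q)%N) L1); apply: perm_size.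
have QE (q r : nat) : k = (q * r)%N -> (0 < r)%N ->
    (Q / 2 < q%:R) && (q%:R <= Q) = (r%:R * Q / 2 < k%:R) && (k%:R <= r%:R * Q).
  move=> -> r0; have r0' : (0 : R) < r%:R by rewrite ltr0n.
  by rewrite mulnC natrM -mulrA ltr_pM2l // ler_pM2l.
have memL1 q : q \in L1 = [&& Q / 2 < q%:R, q%:R <= Q & (q %| k)%N].
  rewrite mem_filter /= mem_index_iota ltnS truncn_ge_nat ?(ltW Q0) //.
  case: (boolP (q %| k)%N) => qk; last by rewrite !andbF.
  by rewrite (dvdn_gt0 k0 qk) !andbT.
have memL2 r : r \in L2 = [&& r%:R * Q / 2 < k%:R, k%:R <= r%:R * Q & (r %| k)%N].
  rewrite mem_filter /= mem_index_iota ltnS truncn_ge_nat ?(ltW Q0) //.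
  case: (boolP (r %| k)%N) => rk; last by rewrite !andbF.
  (* The range restriction [r <= Q] is implied: [r Q / 2 < k <= Q^2 / 2]. *)
  rewrite (dvdn_gt0 k0 rk) !andbT /=; apply: andb_idr => /andP[h1 _].
  have := lt_le_trans h1 kQ; rewrite expr2 ltr_pM2r ?invr_gt0 // ltr_pM2r //.
  exact: ltW.
apply: uniq_perm.
- rewrite map_inj_in_uniq ?filter_uniq ?iota_uniq // => q q'.
  rewrite !memL1 => /and3P[_ _ qk] /and3P[_ _ qk'] e.
  have r0 : (0 < k %/ q)%N by rewrite divn_gt0 ?(dvdn_gt0 k0 qk) // dvdn_leq.
  have : (q * (k %/ q) = q' * (k %/ q))%N by rewrite {2}e ![(_ * (k %/ _))%N]mulnC !divnK.
  by move/eqP; rewrite (eqn_pmul2r r0) => /eqP.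
- by rewrite filter_uniq ?iota_uniq.
move=> r; rewrite memL2; apply/mapP/idP => [[q]|].
  rewrite memL1 => /and3P[h1 h2 qk] ->.
  have kE : k = (q * (k %/ q))%N by rewrite mulnC divnK.
  have r0 : (0 < k %/ q)%N by rewrite divn_gt0 ?(dvdn_gt0 k0 qk) // dvdn_leq.
  by rewrite andbA -(QE _ _ kE r0) h1 h2 /= {2}kE dvdn_mull.
case/and3P=> h1 h2 rk; have r0 := dvdn_gt0 k0 rk.
have kE : k = (k %/ r * r)%N by rewrite divnK.
exists (k %/ r)%N; last first.
  by rewrite {1}kE mulKn // divn_gt0 // dvdn_leq.
by rewrite memL1 andbA (QE _ _ kE r0) h1 h2 /= {2}kE dvdn_mulr.
Qed.

Lemma dyadic_count Q : 0 < Q ->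
  `|\sum_(1 <= q < (Num.truncn Q).+1) (Q / 2 < q%:R)%R%:R - Q / 2| <= 1.
Proof.
move=> Q0.
have Q2 : 0 <= Q / 2 by lra.
have ZQ : (Num.truncn (Q / 2) <= Num.truncn Q)%N by apply: le_truncn; lra.
have -> : \sum_(1 <= q < (Num.truncn Q).+1) (Q / 2 < q%:R)%R%:R
    = (Num.truncn Q)%:R - (Num.truncn (Q / 2))%:R :> R.
  transitivity (\sum_(1 <= q < (Num.truncn Q).+1) (1 - (q%:R <= Q / 2)%R%:R * 1) : R).
    by apply: eq_bigr => q _; rewrite ltNge; case: (_ <= _); rewrite ?mulr1 ?mul0r ?subrr ?subr0.
  rewrite sumrB (sum_threshold (fun=> 1) ZQ); last first.
    by move=> s _; rewrite truncn_ge_nat.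
  by rewrite !sumr_const_nat !subn1.
have /andP[a1 a2] := truncn_itv (ltW Q0).
have /andP[b1 b2] := truncn_itv Q2.
move: a2 b2; rewrite -(natr1 (Num.truncn Q)) -(natr1 (Num.truncn (Q / 2))) => a2 b2.
by rewrite ler_norml; apply/andP; split; lra.
Qed.

(** The admissible [m] form two intervals, one on each side of [n], so their indicator is a signed
    sum of four indicators of initial segments. *)
Lemma dyadic_window Q (r n X : nat) (F : nat -> R) (B : R) : 0 < Q ->
  (forall Z, (Z <= X)%N -> `|\sum_(1 <= m < Z.+1) F m| <= B) ->
  `|\sum_(1 <= m < X.+1) (dyadic_dist Q r m n)%:R * F m| <= 4 * B.
Proof.
move=> Q0 FB.
have down (p : pred nat) : (forall s s', (s <= s')%N -> p s' -> p s) ->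
    `|\sum_(1 <= m < X.+1) (p m)%:R * F m| <= B.
  move=> dp; have [Z ZX HZ] := down_threshold X dp.
  by rewrite (sum_threshold _ ZX HZ) FB.
have downlt (t : R) : `|\sum_(1 <= m < X.+1) (m%:R < t)%R%:R * F m| <= B.
  by apply: down => s s' ss'; apply: le_lt_trans; rewrite ler_nat.
have downle (t : R) : `|\sum_(1 <= m < X.+1) (m%:R <= t)%R%:R * F m| <= B.
  by apply: down => s s' ss'; apply: le_trans; rewrite ler_nat.
pose t := r%:R * Q.
have t0 : 0 <= t by rewrite mulr_ge0 // ltW.
have -> : \sum_(1 <= m < X.+1) (dyadic_dist Q r m n)%:R * F m
  = \sum_(1 <= m < X.+1) (m%:R < n%:R - t / 2)%R%:R * F m
  - \sum_(1 <= m < X.+1) (m%:R < n%:R - t)%R%:R * F m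
  + \sum_(1 <= m < X.+1) (m%:R <= n%:R + t)%R%:R * F m
  - \sum_(1 <= m < X.+1) (m%:R <= n%:R + t / 2)%R%:R * F m.
  rewrite -!sumrB -big_split -sumrB /=; apply: eq_bigr => m _.
  rewrite -!mulrBl -mulrDl -mulrBl; congr (_ * _).
  rewrite /dyadic_dist -/t ltr_normr ler_norml.
  have -> : (m%:R < n%:R - t / 2) = (t / 2 < - (m%:R - n%:R)).
    by apply/idP/idP; lra.
  have -> : (m%:R < n%:R - t) = (m%:R - n%:R < - t) by apply/idP/idP; lra.
  have -> : (m%:R <= n%:R + t) = (m%:R - n%:R <= t) by apply/idP/idP; lra.
  have -> : (m%:R <= n%:R + t / 2) = (m%:R - n%:R <= t / 2) by apply/idP/idP; lra.
  move: (m%:R - n%:R) => d.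
  case: (lerP d t) => h1; case: (lerP (- t) d) => h2;
    case: (lerP d (t / 2)) => h3; case: (ltrP (t / 2) (- d)) => h4 /=; lra.
have := downlt (n%:R - t / 2); have := downlt (n%:R - t).
have := downle (n%:R + t / 2); have := downle (n%:R + t).
rewrite !ler_norml => /andP[? ?] /andP[? ?] /andP[? ?] /andP[? ?].
by apply/andP; split; lra.
Qed.
End Switching.

(** * The two error terms for a real sequence *)

Section RealVariance.
Variable R : realType.
Implicit Types (Q x : R) (b al : nat -> R).

Lemma dist_le_truncn x (X m n : nat) : 0 <= x -> X = Num.truncn x ->
  (0 < m <= X)%N -> (0 < n <= X)%N -> `|m%:R - n%:R| <= x.
Proof.
move=> x0 -> /andP[m0 mX] /andP[n0 nX].
rewrite truncn_ge_nat // in mX; rewrite truncn_ge_nat // in nX.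
have : (0 : R) <= m%:R by []. have : (0 : R) <= n%:R by [].
by rewrite ler_norml => *; apply/andP; split; lra.
Qed.

(** For fixed [r] and [n], the sum over [m] runs over a window and its kernel depends only on the
    class of [n] modulo [r]; four partial sums bounded by [S r c] control it. Grouping [n] by
    classes gives the shape of the progressions condition. *)
Lemma dyadic_progression_error x Q b al (S : nat -> nat -> R) :
  0 < Q -> 0 < x -> 2 * x <= Q ^+ 2 -> (forall n, `|b n| <= al n) ->
  (forall r c Z, (0 < r <= Num.truncn (2 * x / Q))%N -> (0 < c <= r)%N ->
     (Z <= Num.truncn x)%N ->
     `|\sum_(1 <= m < Z.+1) b m * prog_kernel R r m c| <= S r c) ->
  `|\sum_(1 <= m < (Num.truncn x).+1) \sum_(1 <= n < (Num.truncn x).+1)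
      b m * b n * \sum_(1 <= r < (Num.truncn Q).+1)
        (dyadic_dist Q r m n)%:R * prog_kernel R r m n|
  <= 4 * \sum_(1 <= r < (Num.truncn (2 * x / Q)).+1) \sum_(1 <= c < r.+1)
      (\sum_(1 <= n < (Num.truncn x).+1 | (n == c %[mod r])%N) al n) * S r c.
Proof.
move=> Q0 x0 xQ bal HS.
set X := Num.truncn x; set R0 := Num.truncn (2 * x / Q).
have xQ0 : 0 <= 2 * x / Q by rewrite divr_ge0 //; lra.
have R0Q : (R0 <= Num.truncn Q)%N.
  by apply: le_truncn; rewrite ler_pdivrMr // -expr2.
have -> : \sum_(1 <= m < X.+1) \sum_(1 <= n < X.+1)
      b m * b n * \sum_(1 <= r < (Num.truncn Q).+1)
        (dyadic_dist Q r m n)%:R * prog_kernel R r m n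
  = \sum_(1 <= r < R0.+1) \sum_(1 <= n < X.+1) b n * \sum_(1 <= m < X.+1)
      (dyadic_dist Q r m n)%:R * (b m * prog_kernel R r m n).
  transitivity (\sum_(1 <= m < X.+1) \sum_(1 <= n < X.+1)
      \sum_(1 <= r < R0.+1) b n * ((dyadic_dist Q r m n)%:R
        * (b m * prog_kernel R r m n))).
    rewrite big_nat [RHS]big_nat; apply: eq_bigr => m mX.
    rewrite big_nat [RHS]big_nat; apply: eq_bigr => n nX.
    (* Moduli [r > 2x/Q] contribute nothing, as [|m - n| <= x < r Q / 2]. *)
    rewrite (big_cat_nat _ (n := R0.+1)) //= [X in _ + X]big1_seq ?addr0; last first.
      move=> r; rewrite mem_index_iota => /= /andP[R0r _].
      suff -> : dyadic_dist Q r m n = false by rewrite mul0r.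
      apply/negbTE; rewrite negb_and -leNgt; apply/orP; left.
      apply: le_trans (dist_le_truncn (ltW x0) erefl mX nX) _.
      move: R0r; rewrite /R0 truncn_lt_nat // ltr_pdivrMr //; lra.
    by rewrite mulr_sumr; apply: eq_bigr => r _; ring.
  rewrite exchange_big /=; under eq_bigr do rewrite exchange_big /=.
  rewrite exchange_big /=; apply: eq_bigr => r _; apply: eq_bigr => n _.
  by rewrite mulr_sumr.
apply: le_trans (ler_norm_sum _ _ _) _.
rewrite mulr_sumr big_nat [leRHS]big_nat; apply: ler_sum => r rR0.
have r0 : (0 < r)%N by case/andP: rR0.
apply: le_trans (ler_norm_sum _ _ _) _.
apply: (@le_trans _ _ (\sum_(1 <= n < X.+1) al n
    * \sum_(1 <= c < r.+1) (n == c %[mod r])%N%:R * (4 * S r c))).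
  apply: ler_sum => n _; rewrite normrM; apply: ler_pM => //.
  (* Inserting the sum over [c] of the indicator of [n = c mod r] selects the class of [n]. *)
  set D := `|_|; rewrite -(@sum_residue R r n (fun=> D)) // /D {D}.
  rewrite big_nat [leRHS]big_nat; apply: ler_sum => c cr.
  case: (boolP (n == c %[mod r])%N) => [/eqP nc|_]; last by rewrite !mul0r.
  rewrite !mul1r.
  under eq_bigr => m _ do rewrite (prog_kernel_eqmod _ _ nc).
  by apply: dyadic_window => // Z ZX; exact: HS.
under eq_bigr do rewrite mulr_sumr.
rewrite exchange_big mulr_sumr /=; apply: ler_sum => c _.
rewrite [X in 4 * (X * _)]big_mkcond mulr_suml mulr_sumr le_eqVlt; apply/orP; left; apply/eqP.
by apply: eq_bigr => n _; case: eqP => _ /=; ring.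
Qed.

(** The case [j = 0] is set apart because division by zero would give 0 there, whereas the innermost
    shell needs the constant bound of [dyadic_diff_near]. *)
Definition dyadic_decay (j : nat) : R :=
  if j == 0%N then 1 else (3 + ln j%:R) / j%:R.

Lemma dyadic_decay_ge0 (j : nat) : 0 <= dyadic_decay j.
Proof.
rewrite /dyadic_decay; case: eqP => // j0.
by rewrite divr_ge0 // addr_ge0 // ln_ge0 // ler1n; lia.
Qed.

(** With [L = ln t], the harmonic bound gives [1 + (3 + L)(1 + L) = (2 + L)^2]. Since [t >= 2]
    forces [L >= 1/2], this is at most [(5 L)^2]. *)
Lemma sum_dyadic_decay (t : R) : 2 <= t ->
  \sum_(0 <= j < (Num.truncn t).+1) dyadic_decay j <= 25 * ln t ^+ 2.
Proof.
move=> t2; set J := Num.truncn t.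
have J0 : (0 < J)%N by rewrite truncn_gt0; lra.
have Jt : J%:R <= t by rewrite truncn_le; lra.
have J1 : (1 : R) <= J%:R by rewrite ler1n.
have L2 : 1 / 2 <= ln t.
  have := @ln_le_sub1 R t^-1; rewrite lnV ?posrE ?invr_gt0; try lra.
  have : t^-1 <= 2^-1 by rewrite lef_pV2 ?posrE; lra.
  by move=> h /(_ ltac:(lra)); lra.
have lnJ : ln J%:R <= ln t by rewrite ler_ln ?posrE; lra.
rewrite big_ltn //= {1}/dyadic_decay eqxx.
apply: (@le_trans _ _ (1 + (3 + ln t) * (1 + ln t))); last by nra.
rewrite lerD2l.
apply: (@le_trans _ _ ((3 + ln t) * \sum_(1 <= j < J.+1) j%:R^-1)); last first.
  by rewrite ler_wpM2l; [|lra|have := harmonic_le R J0; lra].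
rewrite mulr_sumr big_nat [leRHS]big_nat; apply: ler_sum => j /andP[j0 jJ].
rewrite /dyadic_decay gtn_eqF // ler_wpM2r ?invr_ge0 // lerD2l.
have j1 : (1 : R) <= j%:R by rewrite ler1n.
have jJ' : (j%:R : R) <= J%:R by rewrite ler_nat.
by rewrite ler_ln ?posrE; lra.
Qed.

(* The shells [j Q / 2 <= |m - n| <= (j + 1) Q / 2] consist of two intervals of
   length [Q / 2] each; the sparsity hypothesis bounds each of them. *)
Lemma sum_dyadic_diff_sparse x Q al (h m : nat) (B : R) :
  0 < Q -> Q <= x -> 2 * x <= Q ^+ 2 -> (forall n, 0 <= al n) ->
  (0 < h)%N -> (0 < m <= Num.truncn x %/ h)%N ->
  (forall u : R, \sum_(1 <= n < (Num.truncn x %/ h).+1 | u <= n%:R <= u + Q / 2)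
      al (h * n)%N * (tau n)%:R <= B) ->
  \sum_(1 <= n < (Num.truncn x %/ h).+1) al (h * n)%N * `|dyadic_diff Q h m n|
  <= 1600 * ln (2 * x / Q) ^+ 2 * B * (tau m)%:R.
Proof.
move=> Q0 Qx xQ al0 h0 mX HB; set X := (Num.truncn x %/ h)%N; set t := 2 * x / Q.
have x0 : 0 < x by lra.
have h1 : (1 : R) <= h%:R by rewrite ler1n.
have t2 : 2 <= t by rewrite ler_pdivlMr //; lra.
pose inI (u : R) (n : nat) := u <= n%:R <= u + Q / 2.
pose up j : R := m%:R + j%:R * (Q / 2).
pose lo j : R := m%:R - (j%:R + 1) * (Q / 2).
have B0 : 0 <= B.
  by apply: le_trans (HB 0); apply: sumr_ge0 => n _; rewrite mulr_ge0.
(* The shell containing [n] is replaced by a sum over all shells, whose terms are nonnegative; this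
   makes the later sums over [n] and [j] independent. *)
have key n : (0 < n <= X)%N -> `|dyadic_diff Q h m n| <=
    32 * (tau m)%:R * (tau n)%:R * \sum_(0 <= j < (Num.truncn t).+1)
      dyadic_decay j * ((inI (up j) n)%:R + (inI (lo j) n)%:R).
  move=> nX; have [k kE] : exists k : R, k = `|m%:R - n%:R| by eexists.
  have k0 : 0 <= k by rewrite kE.
  have hk : h%:R * k <= x.
    rewrite kE -[X in X * _](normr_nat R h) -normrM mulrBr -!natrM.
    have XE i : (0 < i <= X)%N -> (0 < h * i <= Num.truncn x)%N.
      by rewrite /X leq_divRL // muln_gt0 h0 mulnC.
    by apply: (dist_le_truncn (ltW x0) erefl); apply: XE.
  pose j := Num.truncn (k / (Q / 2)).
  have kQ0 : 0 <= k / (Q / 2) by rewrite divr_ge0 //; lra.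
  have /andP[j1 j2] := truncn_itv kQ0; rewrite -/j in j1 j2.
  rewrite ler_pdivlMr in j1; last lra.
  rewrite ltr_pdivrMr in j2; last lra.
  rewrite -(natr1 j) in j2.
  (* Since [t Q / 2 = x] and [k <= h k <= x], the shell index never exceeds [t]. *)
  have jt : (j <= Num.truncn t)%N.
    apply: le_truncn; rewrite ler_pdivrMr; last lra.
    have -> : t * (Q / 2) = x by rewrite /t; field; rewrite gt_eqF.
    nra.
  have shell : 1 <= (inI (up j) n)%:R + (inI (lo j) n)%:R :> R.
    suff: inI (up j) n || inI (lo j) n.
      by case: (inI _ _); case: (inI _ _) => //=; lra.
    rewrite /inI /up /lo; case: (lerP n%:R (m%:R : R)) => nm.
      rewrite kE ger0_norm in j1 j2; last lra.
      by apply/orP; right; apply/andP; split; lra.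
    rewrite kE ltr0_norm in j1 j2; last lra.
    by apply/orP; left; apply/andP; split; lra.
  have t1 i : (0 < i)%N -> (1 : R) <= (tau i)%:R by move=> i0; rewrite ler1n tau_gt0.
  have [m0 n0] : (0 < m)%N /\ (0 < n)%N by split; [case/andP: mX|case/andP: nX].
  have tm := t1 _ m0; have tn := t1 _ n0.
  apply: (@le_trans _ _ (32 * (tau m)%:R * (tau n)%:R * dyadic_decay j)).
    rewrite /dyadic_decay; case: eqP => [j0|/eqP]; last first.
      rewrite -lt0n => j0; rewrite -(mulrA 32); apply: dyadic_diff_far => //.
        by rewrite -kE.
      by rewrite -kE; lra.
    apply: le_trans (dyadic_diff_near Q0 h0 _) _; last by nra.
    by rewrite -kE; move: j2; rewrite j0 add0r mul1r => /ltW.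
  rewrite ler_wpM2l //.
  rewrite (bigD1_seq j) ?iota_uniq ?mem_index_iota ?ltnS //=.
  have d0 := dyadic_decay_ge0 j.
  rewrite -[leLHS]addr0; apply: lerD; first by rewrite ler_peMr.
  by apply: sumr_ge0 => i _; rewrite mulr_ge0 ?dyadic_decay_ge0 ?addr_ge0.
apply: (@le_trans _ _ (\sum_(1 <= n < X.+1) 32 * (tau m)%:R *
   \sum_(0 <= j < (Num.truncn t).+1) dyadic_decay j *
     ((inI (up j) n)%:R * (al (h * n)%N * (tau n)%:R)
      + (inI (lo j) n)%:R * (al (h * n)%N * (tau n)%:R)))).
  rewrite big_nat [leRHS]big_nat; apply: ler_sum => n nX.
  apply: le_trans (ler_wpM2l (al0 _) (key n nX)) _.
  rewrite le_eqVlt; apply/orP; left; apply/eqP.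
  by rewrite !mulr_sumr; apply: eq_bigr => j _; ring.
rewrite -mulr_sumr exchange_big /=.
(* The constant is [32] from a far pair, [25] from the sum over shells, and [2] for the two
   intervals of a shell. *)
have -> : 1600 * ln t ^+ 2 * B * (tau m)%:R
   = 32 * (tau m)%:R * (25 * ln t ^+ 2 * (2 * B)) by ring.
rewrite ler_wpM2l //.
apply: (@le_trans _ _ (\sum_(0 <= j < (Num.truncn t).+1) dyadic_decay j * (2 * B))).
  apply: ler_sum => j _; rewrite -mulr_sumr ler_wpM2l ?dyadic_decay_ge0 //.
  have inB u : \sum_(1 <= n < X.+1) (inI u n)%:R * (al (h * n)%N * (tau n)%:R) <= B.
    apply: le_trans (HB u); rewrite [leRHS]big_mkcond; apply: ler_sum => n _.
    by rewrite /inI; case: ifP => _; rewrite ?mul1r ?mul0r.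
  rewrite big_split /=; have := inB (up j); have := inB (lo j); lra.
by rewrite -mulr_suml ler_wpM2r ?mulr_ge0 // sum_dyadic_decay.
Qed.

(** The sum is organised by the common divisor [h]. If [h >= 2x/Q], the quotients differ by at most
    [x / h <= Q / 2], so the constant bound 8 leaves a square as in non-concentration. For smaller
    [h] the shell estimate applies and leaves a factor [tau] of the other quotient. *)
Lemma dyadic_weight_error x Q b al (B : R) :
  0 < Q -> Q <= x -> 2 * x <= Q ^+ 2 ->
  (forall n, `|b n| <= al n) ->
  (forall h (u : R), (0 < h)%N -> h%:R <= 2 * x / Q ->
     \sum_(1 <= n < (Num.truncn x %/ h).+1 | u <= n%:R <= u + Q / 2)
      al (h * n)%N * (tau n)%:R <= B) ->
  `|\sum_(1 <= m < (Num.truncn x).+1) \sum_(1 <= n < (Num.truncn x).+1)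
      b m * b n * \sum_(1 <= q < (Num.truncn Q).+1)
        ((dyadic_dist Q q m n)%:R - (Q / 2 < q%:R)%R%:R) * gcd_weight R q m n|
  <= 8 * \sum_(1 <= h < (Num.truncn Q).+1 | 2 * x / Q <= h%:R)
       (\sum_(1 <= n < (Num.truncn x).+1 | (h %| n)%N) al n) ^+ 2
     + 1600 * ln (2 * x / Q) ^+ 2
       * (B * \sum_(1 <= n < (Num.truncn x).+1) al n * (tau3 n)%:R).
Proof.
move=> Q0 Qx xQ bal HB; set X := Num.truncn x; set QN := Num.truncn Q.
have x0 : 0 < x by lra.
have al0 n : 0 <= al n by apply: le_trans (bal n).
have t2 : 2 <= 2 * x / Q by rewrite ler_pdivlMr //; lra.
have B0 : 0 <= B.
  apply: le_trans (HB 1%N 0 isT _); last lra.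
  by apply: sumr_ge0 => n _; rewrite mulr_ge0.
have C0 : 0 <= 1600 * ln (2 * x / Q) ^+ 2.
  by apply: mulr_ge0; [exact: ler0n|exact: sqr_ge0].
have dE m n : \sum_(1 <= q < QN.+1)
      ((dyadic_dist Q q m n)%:R - (Q / 2 < q%:R)%R%:R) * gcd_weight R q m n
    = \sum_(1 <= h < QN.+1) ((h %| m)%N && (h %| n)%N)%:R
        * dyadic_diff Q h (m %/ h) (n %/ h).
  rewrite (sum_gcd_weight QN m n (fun q => (dyadic_dist Q q m n)%:R - (Q / 2 < q%:R)%R%:R)).
  rewrite big_nat [RHS]big_nat; apply: eq_bigr => h /andP[h0 _].
  case: (boolP ((h %| m) && (h %| n))%N) => [/andP[hm hn]|_]; last by rewrite !mul0r.
  rewrite !mul1r /dyadic_diff; apply: eq_bigr => s _.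
  by rewrite -{1}(divnK hm) -{1}(divnK hn) ![(_ %/ h * h)%N]mulnC dyadic_dist_mul.
pose E h := \sum_(1 <= m < (X %/ h).+1) al (h * m)%N *
  \sum_(1 <= n < (X %/ h).+1) al (h * n)%N * `|dyadic_diff Q h m n|.
apply: (@le_trans _ _ (\sum_(1 <= h < QN.+1) E h)).
  apply: (@le_trans _ _ (\sum_(1 <= h < QN.+1) \sum_(1 <= m < X.+1 | (h %| m)%N)
      \sum_(1 <= n < X.+1 | (h %| n)%N)
        al m * (al n * `|dyadic_diff Q h (m %/ h) (n %/ h)|))).
    apply: le_trans (ler_norm_sum _ _ _) _.
    apply: (@le_trans _ _ (\sum_(1 <= m < X.+1) \sum_(1 <= n < X.+1)
       \sum_(1 <= h < QN.+1) ((h %| m)%N && (h %| n)%N)%:R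
         * (al m * (al n * `|dyadic_diff Q h (m %/ h) (n %/ h)|)))).
      apply: ler_sum => m _; apply: le_trans (ler_norm_sum _ _ _) _.
      apply: ler_sum => n _; rewrite dE normrM.
      apply: (@le_trans _ _ (al m * al n * \sum_(1 <= h < QN.+1)
         ((h %| m)%N && (h %| n)%N)%:R * `|dyadic_diff Q h (m %/ h) (n %/ h)|)).
        apply: ler_pM => //; first by rewrite normrM ler_pM.
        apply: le_trans (ler_norm_sum _ _ _) _; apply: ler_sum => h _.
        by rewrite normrM normr_nat.
      rewrite mulr_sumr; apply: ler_sum => h _; rewrite le_eqVlt; apply/orP; left.
      by apply/eqP; ring.
    under eq_bigr do rewrite exchange_big /=.
    rewrite exchange_big /=; apply: ler_sum => h _.
    rewrite [leRHS]big_mkcond; apply: ler_sum => m _.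
    case: ifP => hm; last by rewrite big1 // => n _; rewrite mul0r.
    rewrite [leRHS]big_mkcond; apply: ler_sum => n _.
    by case: ifP => hn /=; rewrite ?mul1r ?mul0r.
  rewrite big_nat [leRHS]big_nat; apply: ler_sum => h /andP[h0 _].
  rewrite sum_multiples //; apply: ler_sum => m _.
  rewrite sum_multiples // mulr_sumr; apply: ler_sum => n _.
  by rewrite !mulKn.
rewrite (bigID (fun h : nat => 2 * x / Q <= h%:R)) /=; apply: lerD.
  rewrite mulr_sumr big_nat_cond [leRHS]big_nat_cond.
  apply: ler_sum => h /andP[/andP[h0 _] hx].
  rewrite sum_multiples // expr2 mulr_suml mulr_sumr /E.
  rewrite big_nat [leRHS]big_nat; apply: ler_sum => m mX.
  rewrite mulrCA ler_wpM2l // mulr_sumr.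
  rewrite big_nat [leRHS]big_nat; apply: ler_sum => n nX.
  rewrite mulrC ler_wpM2r //; apply: dyadic_diff_near => //.
  have h1 : (0 : R) < h%:R by rewrite ltr0n.
  have : h%:R * `|m%:R - n%:R| <= x.
    rewrite -[X in X * _](normr_nat R h) -normrM mulrBr -!natrM.
    have XE i : (0 < i < (X %/ h).+1)%N -> (0 < h * i <= Num.truncn x)%N.
      by rewrite ltnS leq_divRL // muln_gt0 h0 mulnC.
    by apply: (dist_le_truncn (ltW x0) erefl); apply: XE.
  move: hx; rewrite ler_pdivrMr // => hx hk.
  by rewrite -(ler_pM2l h1); lra.
apply: (@le_trans _ _ (\sum_(1 <= h < QN.+1) 1600 * ln (2 * x / Q) ^+ 2 * B
   * \sum_(1 <= m < (X %/ h).+1) al (h * m)%N * (tau m)%:R)).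
  rewrite [leLHS]big_mkcond big_nat [leRHS]big_nat; apply: ler_sum => h /andP[h0 _].
  case: ifP => [|_]; last first.
    apply: mulr_ge0; first exact: mulr_ge0.
    by apply: sumr_ge0 => i _; rewrite mulr_ge0.
  rewrite -ltNge => /ltW hx; rewrite /E mulr_sumr.
  rewrite big_nat [leRHS]big_nat; apply: ler_sum => m mX.
  rewrite mulrCA ler_wpM2l //.
  by apply: sum_dyadic_diff_sparse => // u; exact: HB.
rewrite -mulr_sumr -mulrA; apply: ler_wpM2l C0 _ _ _; apply: ler_wpM2l B0 _ _ _.
(* Back in terms of [m], the factor [tau(m / h)] summed over the divisors [h] of [m] is at most
   [tau3 m]. *)
apply: (@le_trans _ _ (\sum_(1 <= h < QN.+1) \sum_(1 <= m < X.+1 | (h %| m)%N)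
    al m * (tau (m %/ h))%:R)).
  rewrite big_nat [leRHS]big_nat; apply: ler_sum => h /andP[h0 _].
  by rewrite sum_multiples //; apply: ler_sum => m _; rewrite mulKn.
under [leLHS]eq_bigr do rewrite big_mkcond.
rewrite exchange_big /= big_nat [leRHS]big_nat; apply: ler_sum => m /andP[m0 mX].
rewrite -big_mkcond -mulr_sumr ler_wpM2l //.
apply: (@le_trans _ _ (\sum_(h <- divisors m) tau (m %/ h))%N%:R); last first.
  by rewrite ler_nat sum_tau_le_tau3.
rewrite natr_sum (sum_divisors_range (B := maxn m QN)) ?m0 ?leq_maxl //.
rewrite big_mkcond [leRHS]big_mkcond.
by apply: sum_nat_widen => [|i]; [exact: leq_maxr|case: ifP].
Qed.
End RealVariance.

(** * Real and imaginary parts *)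

Section Variance.
Variable R : realType.
Implicit Types (Q x z : R) (a : nat -> R[i]) (b al : nat -> R).

(** Exact decomposition: the diagonal, the switched congruences minus their expected weights, and
    the difference of the weights on the two dyadic ranges. The last sum on the right pays for
    counting the integers in [(Q/2, Q]] as [Q / 2]. *)
Lemma variance_real x Q b al (S : nat -> nat -> R) (B : R) :
  0 < Q -> Q <= x -> 2 * x <= Q ^+ 2 -> (forall n, `|b n| <= al n) ->
  (forall r c Z, (0 < r <= Num.truncn (2 * x / Q))%N -> (0 < c <= r)%N ->
     (Z <= Num.truncn x)%N ->
     `|\sum_(1 <= m < Z.+1) b m * prog_kernel R r m c| <= S r c) ->
  (forall h (u : R), (0 < h)%N -> h%:R <= 2 * x / Q ->
     \sum_(1 <= n < (Num.truncn x %/ h).+1 | u <= n%:R <= u + Q / 2)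
      al (h * n)%N * (tau n)%:R <= B) ->
  `|\sum_(1 <= q < (Num.truncn Q).+1 | Q / 2 < q%:R) \sum_(1 <= c < q.+1)
      (\sum_(1 <= m < (Num.truncn x).+1) b m * prog_kernel R q m c) ^+ 2
    - Q / 2 * \sum_(1 <= n < (Num.truncn x).+1) b n ^+ 2|
  <= 4 * (\sum_(1 <= r < (Num.truncn (2 * x / Q)).+1) \sum_(1 <= c < r.+1)
      (\sum_(1 <= n < (Num.truncn x).+1 | (n == c %[mod r])%N) al n) * S r c)
   + (8 * \sum_(1 <= h < (Num.truncn Q).+1 | 2 * x / Q <= h%:R)
       (\sum_(1 <= n < (Num.truncn x).+1 | (h %| n)%N) al n) ^+ 2
     + 1600 * ln (2 * x / Q) ^+ 2
       * (B * \sum_(1 <= n < (Num.truncn x).+1) al n * (tau3 n)%:R))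
   + \sum_(1 <= n < (Num.truncn x).+1) al n ^+ 2.
Proof.
move=> Q0 Qx xQ bal HS HB; have x0 : 0 < x by lra.
have e1 := dyadic_progression_error Q0 x0 xQ bal HS.
have e2 := dyadic_weight_error Q0 Qx xQ bal HB.
have e3 := dyadic_count Q0.
set cnt := \sum_(1 <= q < _) _ in e3.
have e4 : \sum_(1 <= n < (Num.truncn x).+1) b n ^+ 2
    <= \sum_(1 <= n < (Num.truncn x).+1) al n ^+ 2.
  apply: ler_sum => n _; rewrite -[b n ^+ 2]ger0_norm ?sqr_ge0 // normrX.
  by rewrite ler_pXn2r // ?nnegrE // (le_trans _ (bal n)).
have e5 : 0 <= \sum_(1 <= n < (Num.truncn x).+1) b n ^+ 2.
  by apply: sumr_ge0 => n _; exact: sqr_ge0.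
have -> : \sum_(1 <= q < (Num.truncn Q).+1 | Q / 2 < q%:R) \sum_(1 <= c < q.+1)
      (\sum_(1 <= m < (Num.truncn x).+1) b m * prog_kernel R q m c) ^+ 2
  = cnt * \sum_(1 <= n < (Num.truncn x).+1) b n ^+ 2
  + \sum_(1 <= m < (Num.truncn x).+1) \sum_(1 <= n < (Num.truncn x).+1)
      b m * b n * (\sum_(1 <= r < (Num.truncn Q).+1)
        (dyadic_dist Q r m n)%:R * prog_kernel R r m n)
  + \sum_(1 <= m < (Num.truncn x).+1) \sum_(1 <= n < (Num.truncn x).+1)
      b m * b n * (\sum_(1 <= q < (Num.truncn Q).+1)
        ((dyadic_dist Q q m n)%:R - (Q / 2 < q%:R)%R%:R) * gcd_weight R q m n).
  transitivity (\sum_(1 <= m < (Num.truncn x).+1) \sum_(1 <= n < (Num.truncn x).+1)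
      \sum_(1 <= q < (Num.truncn Q).+1)
        b m * b n * ((Q / 2 < q%:R)%R%:R * prog_kernel R q m n)).
    rewrite exchange_big /=; under [RHS]eq_bigr do rewrite exchange_big /=.
    rewrite [RHS]exchange_big /= big_mkcond big_nat [RHS]big_nat.
    apply: eq_bigr => q /andP[q0 _]; case: ifP => _.
      rewrite sum_sq_prog_kernel // exchange_big /=.
      by apply: eq_bigr => n _; apply: eq_bigr => m _; rewrite mul1r.
    by rewrite big1 // => n _; rewrite big1 // => m _; rewrite mul0r mulr0.
  have -> : cnt * \sum_(1 <= n < (Num.truncn x).+1) b n ^+ 2
    = \sum_(1 <= m < (Num.truncn x).+1) \sum_(1 <= n < (Num.truncn x).+1)
        b m * b n * (cnt * (m == n)%:R).
    rewrite mulr_sumr big_seq [RHS]big_seq; apply: eq_bigr => m mX.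
    rewrite (bigD1_seq m) ?iota_uniq //= eqxx mulr1 big1 ?addr0.
      by rewrite expr2 mulrC.
    by move=> n /negbTE nm; rewrite eq_sym nm !mulr0.
  rewrite -!big_split /= big_nat [RHS]big_nat; apply: eq_bigr => m mX.
  rewrite -!big_split /= big_nat [RHS]big_nat; apply: eq_bigr => n nX.
  rewrite -mulr_sumr -!mulrDr; congr (_ * _).
  have mnQ : `|m%:R - n%:R| <= Q ^+ 2 / 2.
    by apply: le_trans (dist_le_truncn (ltW x0) erefl mX nX) _; lra.
  (* The diagonal term is eliminated through [divisor_switch]; what remains is an identity for each
     [q] separately. *)
  have /esym/(canRL (addrK _)) := divisor_switch Q0 mnQ; rewrite -/cnt => ->.
  rewrite -sumrB -!big_split /=; apply: eq_bigr => q _.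
  by rewrite /prog_kernel; ring.
move: e1 e2 e3 e4 e5.
move: cnt (\sum_(1 <= n < _) b n ^+ 2) (\sum_(1 <= n < _) al n ^+ 2).
move=> cnt sb sa.
set T1 := \sum_(1 <= m < _) _; set T2 := \sum_(1 <= m < _) _.
set P1 := \sum_(1 <= r < _) _; set P2 := \sum_(1 <= h < _ | _) _.
set P3 := 1600 * _ * _.
rewrite !ler_norml => /andP[e1 e1'] /andP[e2 e2'] /andP[e3 e3'] e4 e5.
have g1 : (cnt - Q / 2) * sb <= sb by rewrite -[leRHS]mul1r ler_wpM2r.
have g2 : - sb <= (cnt - Q / 2) * sb by rewrite -mulN1r ler_wpM2r.
rewrite mulrBl in g1 g2.
by apply/andP; split; lra.
Qed.

Lemma sqr_cabs (w : R[i]) : cabs w ^+ 2 = complex.Re w ^+ 2 + complex.Im w ^+ 2.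
Proof. by case: w => u v; rewrite /cabs /= sqr_sqrtr // addr_ge0 ?sqr_ge0. Qed.

Lemma cabs_ge0 (w : R[i]) : 0 <= cabs w.
Proof. by case: w => u v; rewrite /cabs /= sqrtr_ge0. Qed.

Lemma norm_Re_le_cabs (w : R[i]) : `|complex.Re w| <= cabs w.
Proof.
rewrite -(@ler_pXn2r _ 2) // ?nnegrE ?cabs_ge0 // -normrX ger0_norm ?sqr_ge0 //.
by rewrite sqr_cabs lerDl sqr_ge0.
Qed.

Lemma norm_Im_le_cabs (w : R[i]) : `|complex.Im w| <= cabs w.
Proof.
rewrite -(@ler_pXn2r _ 2) // ?nnegrE ?cabs_ge0 // -normrX ger0_norm ?sqr_ge0 //.
by rewrite sqr_cabs lerDr sqr_ge0.
Qed.

(** Real-linear functionals, so that one argument serves the real and the imaginary part. *)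
Definition real_part_map (f : R[i] -> R) : Prop :=
  {morph f : v w / v + w} /\
  forall (r : R) w, f (real_complex R r * w) = r * f w.

Lemma real_part_map_Re : real_part_map (@complex.Re R).
Proof. by split=> [[? ?] [? ?]//|r [u v]] /=; rewrite mul0r subr0. Qed.

Lemma real_part_map_Im : real_part_map (@complex.Im R).
Proof. by split=> [[? ?] [? ?]//|r [u v]] /=; rewrite mul0r addr0. Qed.

(** The discrepancy is a combination of the [a m] with real coefficients, so [f] passes through
    it. *)
Lemma real_part_discrepancy (f : R[i] -> R) a z (q c : nat) :
  real_part_map f -> (0 < q)%N ->
  f (prog_sum a z q c%:Z - Aver a z q (gcdn c q))
  = \sum_(1 <= m < (Num.truncn z).+1) f (a m) * prog_kernel R q m c.
Proof.
move=> [fD fZ] q0.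
have f0 : f 0 = 0 by have := fZ 0 0; rewrite mulr0 mul0r.
have fN w : f (- w) = - f w.
  by have := fZ (-1) w; rewrite rmorphN1 !mulN1r.
have fsum I (s : seq I) (P : pred I) (F : I -> R[i]) :
    f (\sum_(i <- s | P i) F i) = \sum_(i <- s | P i) f (F i).
  exact: (big_morph f fD f0).
have progE c' : f (prog_sum a z q c'%:Z)
    = \sum_(1 <= n < (Num.truncn z).+1 | (n == c' %[mod q])%N) f (a n).
  rewrite /prog_sum fsum; apply: eq_bigl => n.
  by rewrite !modz_nat eqz_nat.
rewrite -prog_sub_average // fD fN progE; congr (_ - _).
rewrite /Aver -(rmorph_nat (real_complex R)) -fmorphV fZ fsum; congr (_ * _).
by apply: eq_bigr => c' _; exact: progE.
Qed.

Lemma discrepancy_le_sup a x z (r c : nat) : z <= x ->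
  discrepancy a z r c
  <= sup [set discrepancy a z r c | z in [set z : R | z <= x]]%classic.
Proof.
move=> zx; apply: ub_le_sup; last by exists z.
(* The supremum is meaningful only for a bounded set. As the discrepancy depends on [z] through
   [Num.truncn z], the sum of its values at the integers up to [x] is an upper bound. *)
exists (\sum_(0 <= j < (Num.truncn x).+1) discrepancy a j%:R r c).
move=> _ [y /= yx <-].
have -> : discrepancy a y r c = discrepancy a (Num.truncn y)%:R r c.
  by rewrite /discrepancy /Aver /prog_sum natrK.
rewrite (bigD1_seq (Num.truncn y)) ?iota_uniq //=; last first.
  by rewrite mem_index_iota ltnS le_truncn.
by rewrite lerDl sumr_ge0 // => j _; exact: cabs_ge0.
Qed.

Lemma hereditarily_sparse_truncn a x Q (Khered : R) (h : nat) (u : R) :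
  0 <= x -> hereditarily_sparse a x Q Khered -> (0 < h)%N -> h%:R <= 2 * x / Q ->
  \sum_(1 <= n < (Num.truncn x %/ h).+1 | u <= n%:R <= u + Q / 2)
    cabs (a (h * n)%N) * (tau n)%:R
  <= Khered^-1 * (sum_abs a x ^+ 2
      / \sum_(1 <= n < (Num.truncn x).+1) cabs (a n) * (tau3 n)%:R).
Proof.
move=> x0 Hh h0 hx; pose v := u + Q / 2.
have uv : v - u = Q / 2 by rewrite /v addrC addKr.
(* [true] and [false] close the interval at both ends. *)
apply: le_trans (Hh h h0 hx true false u v uv).
pose F n := if u <= n%:R <= v then cabs (zero_ext a x (n * h)) * (tau n)%:R else 0.
have F0 n : 0 <= F n by rewrite /F; case: ifP => // _; rewrite mulr_ge0 ?cabs_ge0.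
rewrite [leRHS]big_mkcond [leLHS]big_mkcond /=.
(* One sum stops at [x / h], the other at [v]; both are compared with the longer range, on which
   terms beyond [v] vanish. *)
apply: (@le_trans _ _ (\sum_(1 <= n < (maxn (Num.truncn x %/ h) (Num.truncn v)).+1) F n)).
  apply: le_trans (sum_nat_widen (leq_maxl _ _) F0).
  rewrite [leLHS]big_nat [leRHS]big_nat; apply: ler_sum => n /andP[n0 nX].
  rewrite /F -/v; case: ifP => // _.
  have nhx : (n * h)%:R <= x by rewrite -truncn_ge_nat // -leq_divRL.
  by rewrite /zero_ext nhx mulnC.
rewrite (big_cat_nat _ (n := (Num.truncn v).+1)) ?ltnS ?leq_maxr //=.
rewrite [X in _ + X]big1_seq ?addr0; last first.
  move=> n; rewrite mem_index_iota => /= /andP[vn _]; rewrite /F.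
  suff -> : (n%:R <= v) = false by rewrite andbF.
  apply/negbTE; rewrite -ltNge; apply: lt_le_trans (truncnS_gt v) _.
  by rewrite ler_nat.
by apply: ler_sum => n _; rewrite /F in_itv.
Qed.

End Variance.

Theorem theorem1 (R : realType) :
  exists C x0 : R, 0 < C /\
  forall (x Q : R) (a : nat -> R[i]) (Kprog : R) (Kconc : R -> R) (Khered : R),
    x0 <= x -> x0 <= Q ->
    Num.sqrt (2 * x) < Q -> Q <= x ->
    0 < Kprog -> progressions_condition a x Q Kprog ->
    (forall H : R, H <= Q -> 0 < Kconc H /\ non_concentration a x Q H (Kconc H)) ->
    0 < Khered -> hereditarily_sparse a x Q Khered ->
    `| Vvar a x Q
       - Q / 2 * \sum_(1 <= n < (Num.truncn x).+1) cabs (a n) ^+ 2 |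
    <= C * (sum_abs a x ^+ 2 *
              (Kprog^-1 + (Kconc (2 * x / Q))^-1
               + ln (2 * x / Q) ^+ 2 / Khered)
            + \sum_(1 <= n < (Num.truncn x).+1) cabs (a n) ^+ 2 * (tau n)%:R).
Proof.
(* The constant is twice 1600, once for each of the real and imaginary parts; the threshold 1 makes
   [x] and [Q] positive. *)
exists 3200, 1; split; first by rewrite ltr0n.
move=> x Q a Kprog Kconc Khered x1 Q1 sQ Qx Kp0 Hprog Hconc Kh0 Hher.
have Q0 : 0 < Q by lra.
have x0 : 0 < x by lra.
have xQ : 2 * x <= Q ^+ 2.
  have x20 : 0 <= 2 * x by lra.
  rewrite -[leLHS](sqr_sqrtr x20) ler_pXn2r ?nnegrE ?sqrtr_ge0 //; exact: ltW.
have [Kc0 Hc] : 0 < Kconc (2 * x / Q)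
    /\ non_concentration a x Q (2 * x / Q) (Kconc (2 * x / Q)).
  by apply: Hconc; rewrite ler_pdivrMr // -expr2.
pose al n := cabs (a n).
pose S r c := sup [set discrepancy a z r c | z in [set z : R | z <= x]]%classic.
pose T3 := \sum_(1 <= n < (Num.truncn x).+1) al n * (tau3 n)%:R.
pose B := Khered^-1 * (sum_abs a x ^+ 2 / T3).
(* The partial sum up to an integer [Z] is the image under [f] of the discrepancy at [z = Z], so the
   same supremum bounds both parts. *)
have part (f : R[i] -> R) : real_part_map f -> (forall w, `|f w| <= cabs w) ->
    forall r c Z, (0 < r <= Num.truncn (2 * x / Q))%N -> (0 < c <= r)%N ->
    (Z <= Num.truncn x)%N ->
    `|\sum_(1 <= m < Z.+1) f (a m) * prog_kernel R r m c| <= S r c.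
  move=> pf fle r c Z /andP[r0 _] _ ZX.
  have zx : Z%:R <= x by rewrite -truncn_ge_nat // ltW.
  apply: le_trans (discrepancy_le_sup a r c zx).
  apply: le_trans (fle _); rewrite (real_part_discrepancy _ _ _ pf r0) natrK //.
have HB h (u : R) : (0 < h)%N -> h%:R <= 2 * x / Q ->
     \sum_(1 <= n < (Num.truncn x %/ h).+1 | u <= n%:R <= u + Q / 2)
      al (h * n)%N * (tau n)%:R <= B.
  exact: (hereditarily_sparse_truncn _ (ltW x0) Hher).
have eRe := variance_real Q0 Qx xQ (fun n => norm_Re_le_cabs (a n))
  (part _ (real_part_map_Re R) (@norm_Re_le_cabs R)) HB.
have eIm := variance_real Q0 Qx xQ (fun n => norm_Im_le_cabs (a n))
  (part _ (real_part_map_Im R) (@norm_Im_le_cabs R)) HB.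
have VE : Vvar a x Q
  = \sum_(1 <= q < (Num.truncn Q).+1 | Q / 2 < q%:R) \sum_(1 <= c < q.+1)
      (\sum_(1 <= m < (Num.truncn x).+1) complex.Re (a m) * prog_kernel R q m c) ^+ 2
  + \sum_(1 <= q < (Num.truncn Q).+1 | Q / 2 < q%:R) \sum_(1 <= c < q.+1)
      (\sum_(1 <= m < (Num.truncn x).+1) complex.Im (a m) * prog_kernel R q m c) ^+ 2.
  rewrite /Vvar -big_split [LHS]big_nat_cond [RHS]big_nat_cond /=.
  apply: eq_bigr => q /andP[/andP[q0 _] _]; rewrite -big_split /=.
  apply: eq_bigr => c _; rewrite /discrepancy sqr_cabs.
  by rewrite (real_part_discrepancy _ _ _ (real_part_map_Re R) q0)
             (real_part_discrepancy _ _ _ (real_part_map_Im R) q0).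
have sE : \sum_(1 <= n < (Num.truncn x).+1) cabs (a n) ^+ 2
  = \sum_(1 <= n < (Num.truncn x).+1) complex.Re (a n) ^+ 2
  + \sum_(1 <= n < (Num.truncn x).+1) complex.Im (a n) ^+ 2.
  by rewrite -big_split; apply: eq_bigr => n _; exact: sqr_cabs.
have BT : B * T3 <= sum_abs a x ^+ 2 / Khered.
  (* If [T3 = 0], the product is 0 and the bound is nonnegative; otherwise [T3] cancels. *)
  have [T0|T0] := eqVneq T3 0.
    by rewrite T0 mulr0 divr_ge0 ?sqr_ge0 // ltW.
  by rewrite /B -mulrA divfK // mulrC.
have tE : \sum_(1 <= n < (Num.truncn x).+1) cabs (a n) ^+ 2
    <= \sum_(1 <= n < (Num.truncn x).+1) cabs (a n) ^+ 2 * (tau n)%:R.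
  rewrite big_nat [leRHS]big_nat; apply: ler_sum => n /andP[n0 _].
  by rewrite ler_peMr ?sqr_ge0 // ler1n tau_gt0.
have t0 : 0 <= \sum_(1 <= n < (Num.truncn x).+1) cabs (a n) ^+ 2.
  by apply: sumr_ge0 => n _; exact: sqr_ge0.
have L0 : 0 <= ln (2 * x / Q) ^+ 2 by exact: sqr_ge0.
have LBT := ler_wpM2l L0 BT.
have p0 : 0 <= sum_abs a x ^+ 2 / Kprog by rewrite divr_ge0 ?sqr_ge0 // ltW.
have k0 : 0 <= sum_abs a x ^+ 2 / Kconc (2 * x / Q) by rewrite divr_ge0 ?sqr_ge0 // ltW.
have q0 : 0 <= ln (2 * x / Q) ^+ 2 * (sum_abs a x ^+ 2 / Khered).
  by rewrite mulr_ge0 // divr_ge0 ?sqr_ge0 // ltW.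
rewrite VE sE mulrDr.
rewrite /progressions_condition in Hprog; rewrite /non_concentration in Hc.
move: eRe eIm Hprog Hc tE t0 LBT p0 k0 q0; rewrite sE.
rewrite -/(S _ _) -/T3 !mulrDr.
have -> : sum_abs a x ^+ 2 * (ln (2 * x / Q) ^+ 2 / Khered)
  = ln (2 * x / Q) ^+ 2 * (sum_abs a x ^+ 2 / Khered) by rewrite mulrCA.
have -> : 1600 * ln (2 * x / Q) ^+ 2 * (B * T3)
  = 1600 * (ln (2 * x / Q) ^+ 2 * (B * T3)) by rewrite -mulrA.
rewrite !ler_norml => /andP[r1 r2] /andP[i1 i2] Hprog Hc tE t0 LBT p0 k0 q0.
by apply/andP; split; lra.
Qed.
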